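(* Let $1<p<\infty$, $q=p/(p-1)$, $p^*=\max\{p,q\}$. For every countable ordinal $\alpha<\omega_1$, the space $R^p_\alpha$ is $(p^*-1)^2(p^*/2)^{3/2}$-orthogonally complemented in its ambient $L_p$-space.
   Context: For a probability space $(\Omega,\mathcal A,\mu)$ and $C>0$, an orthogonal projection $P$ on $L_2(\Omega)$ is $p$-$C$-bounded if $\|Pf\|_p\le C\|f\|_p$ for all $f\in L_2\cap L_p$; a subspace $X\subseteq L_p(\Omega)$ is $C$-orthogonally complemented if it is the $\|\cdot\|_p$-closure of $P(L_2\cap L_p)$ for some such $P$. Disjoint sum: for a subspace $B\subseteq L_p(\Omega,\mathcal A,\mu)$, $(B\oplus B)_p$ is the subspace of $L_p(\Omega\times\{0,1\})$ ($\{0,1\}$ with the fair measure) of functions $b$ such that there are $b_0,b_1\in B$ with $b(\omega,\varepsilon)=b_\varepsilon(\omega)$ for all $\omega$, $\varepsilon\in\{0,1\}$. Independent sum: for subspaces $B_n\subseteq L_p(\Omega_n,\mathcal A_n,\mu_n)$ ($n$ in a countable index set), let $\overline B_n$ be the subspace of $L_p(\prod_n\Omega_n)$ of functions $b(\omega)=f(\omega_n)$ with $f\in B_n$; then $(\sum_nB_n)_{\mathrm{Ind},p}$ is the closed linear span of $\bigcup_n\overline B_n$ in $L_p(\prod_n\Omega_n)$. The spaces $R^p_\alpha$, $\alpha<\omega_1$, are defined recursively: $R^p_0$ is the space of constant functions in $L_p(\{0,1\})$; $R^p_{\alpha+1}=(R^p_\alpha\oplus R^p_\alpha)_p$; for a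 limit ordinal $\beta$, $R^p_\beta=(\sum_{\alpha<\beta}R^p_\alpha)_{\mathrm{Ind},p}$. *)

(* Defs.v *)
From HB Require Import structures.
From mathcomp Require Import all_boot all_order all_algebra.
From mathcomp Require Import all_classical all_reals all_analysis.
Import Order.TTheory GRing.Theory Num.Theory.
Import numFieldNormedType.Exports.
Local Open Scope classical_set_scope. Local Open Scope ring_scope.
(* The universal coin-tossing probability space.                            *)
(* Omega = {0,1}^(seq nat) with the product sigma-algebra (generated by the *)
(* coordinate cylinders) and the product of fair coin measures.  The        *)
(* product measure is obtained as the image of Lebesgue measure on [0,1)    *)
(* under x |-> (binary digits of x), the digit with index (code a) being     *)
(* assigned to coordinate a (code : seq nat -> nat is a bijection).         *)
Definition Omega0 := seq nat -> bool.
Definition cyl : set (set Omega0) :=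
  [set [set w : Omega0 | w a = true] | a in [set: seq nat]].
Definition Omega := g_sigma_algebraType cyl.

Section Coin.
Variable R : realType.
(* the set of x >= 0 whose (n+1)-th binary digit after the point is 1 *)
Definition dig_set (n : nat) : set R :=
  \bigcup_(m in [set: nat])
     `[((2 * m + 1)%:R / 2 ^+ n.+1), ((2 * m + 2)%:R / 2 ^+ n.+1)[%classic.
Definition bits (x : measurableTypeR R) : Omega := fun a => `[< dig_set (CodeSeq.code a) x >].
Lemma m01 : measurable (`[0, 1[%classic : set (measurableTypeR R)).
Proof. exact: measurable_itv. Qed.
Definition lam01 := mrestr (@lebesgue_measure R) m01.
Lemma bits_measurable : measurable_fun setT bits.
Proof.
apply: (@measurability _ _ (measurableTypeR R) Omega setT bits cyl) => //.
move=> _ [_ [a _ <-] <-].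
rewrite setTI.
have -> : bits @^-1` [set w : Omega0 | w a = true] = dig_set (CodeSeq.code a).
  by apply/seteqP; split => x /=; rewrite /bits; case: asboolP.
by apply: bigcupT_measurable => m; exact: measurable_itv.
Qed.
Definition coin := pushforward lam01 bits.
Let coin0 : coin set0 = 0%E.
Proof. rewrite /coin /pushforward preimage_set0; exact: (measure0 lam01). Qed.
Let coin_ge0 A : (0 <= coin A)%E.
Proof.
rewrite /coin /pushforward; apply: (measure_ge0 lam01).
Qed.
Let coin_sigma_additive : semi_sigma_additive coin.
Proof.
move=> F mF tF mUF; rewrite /coin /pushforward preimage_bigcup.
apply: (@measure_semi_sigma_additive _ _ _ lam01).
- by move=> n; rewrite -[X in measurable X]setTI; exact: bits_measurable.
- apply/trivIsetP => /= i j _ _ ij; rewrite -preimage_setI.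
  by move/trivIsetP : tF => /(_ _ _ _ _ ij) ->//; rewrite preimage_set0.
- by rewrite -preimage_bigcup -[X in measurable X]setTI; exact: bits_measurable.
Qed.
HB.instance Definition _ := isMeasure.Build _ _ _ coin coin0 coin_ge0 coin_sigma_additive.
End Coin.
Arguments coin {R}.

(* L_p spaces of sub-products.  For a set I of coordinates, the space       *)
(* L_p({0,1}^I) is represented (isometrically, via w |-> w|_I) as the       *)
(* measurable functions on Omega with finite p-norm that depend only on the *)
(* coordinates in I.                                                        *)
Section Lp.
Variable R : realType.

Definition fsub (f g : Omega -> R) : Omega -> R := fun w => f w - g w.

Definition Lnp (p : R) (f : Omega -> R) : \bar R :=
  'N[coin]_(p%:E)[EFin \o f].

Definition inLp (p : R) (f : Omega -> R) : Prop :=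
  measurable_fun [set: Omega] f /\ (Lnp p f < +oo)%E.

Definition depends_on (I : set (seq nat)) (f : Omega -> R) : Prop :=
  forall w w' : Omega, (forall a, I a -> w a = w' a) -> f w = f w'.

Definition Lsub (p : R) (I : set (seq nat)) : set (Omega -> R) :=
  [set f | inLp p f /\ depends_on I f].

Definition span (S : set (Omega -> R)) : set (Omega -> R) :=
  [set f | exists n (c : 'I_n -> R) (g : 'I_n -> Omega -> R),
     (forall i, S (g i)) /\ f = (fun w => \sum_(i < n) c i * g i w)].

Definition pclosure (p : R) (A S : set (Omega -> R)) : set (Omega -> R) :=
  [set g | A g /\ forall e : R, 0 < e ->
     exists2 h, S h & (Lnp p (fsub g h) < e%:E)%E].

Definition ip (f g : Omega -> R) : \bar R := \int[coin]_w (f w * g w)%:E.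

Definition orth_proj (I : set (seq nat)) (P : (Omega -> R) -> (Omega -> R))
  : Prop :=
  [/\ forall f, Lsub 2 I f -> Lsub 2 I (P f),
      forall f g, Lsub 2 I f -> Lsub 2 I g ->
        Lnp 2 (fsub f g) = 0%E -> Lnp 2 (fsub (P f) (P g)) = 0%E,
      forall (a : R) f g, Lsub 2 I f -> Lsub 2 I g ->
        Lnp 2 (fsub (P (fun w => a * f w + g w)) (fun w => a * P f w + P g w))
          = 0%E,
      forall f, Lsub 2 I f -> Lnp 2 (fsub (P (P f)) (P f)) = 0%E &
      forall f g, Lsub 2 I f -> Lsub 2 I g -> ip (P f) g = ip f (P g)].

Definition p_bounded (p C : R) (I : set (seq nat))
    (P : (Omega -> R) -> (Omega -> R)) : Prop :=
  forall f, Lsub 2 I f -> Lsub p I f -> (Lnp p (P f) <= C%:E * Lnp p f)%E.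

Definition orth_complemented (p C : R) (I : set (seq nat))
    (X : set (Omega -> R)) : Prop :=
  exists P, [/\ orth_proj I P, p_bounded p C I P &
    X = pclosure p (Lsub p I) [set P f | f in Lsub 2 I `&` Lsub p I]].

End Lp.
Arguments fsub {R}.
Arguments Lnp {R}.
Arguments inLp {R}.
Arguments depends_on {R}.
Arguments Lsub {R}.
Arguments span {R}.
Arguments pclosure {R}.
Arguments ip {R}.
Arguments orth_proj {R}.
Arguments p_bounded {R}.
Arguments orth_complemented {R}.

(* The spaces R^p_alpha.  A countable ordinal is represented as an element  *)
(* t of a countable well-order (lt on nat); alpha = order type of           *)
(* {s | lt s t}.  By well-founded recursion we build, for every t, the      *)
(* coordinate set I_t (with Omega_t = {0,1}^{I_t}) and R^p_t inside         *)
(* L_p({0,1}^{I_t}):                                                        *)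
(*  - t minimal:   I_t = {[::]},  R = constants;                            *)
(*  - t = s + 1:   I_t = {[::]} u (0 :: I_s)  (the coordinate [::] is the   *)
(*                 extra fair {0,1} factor), R = (R_s (+) R_s)_p;           *)
(*  - t limit:     I_t = U_{s<t} (s :: I_s)  (the product of the Omega_s),  *)
(*                 R = closed span of the copies  f o shift_s, f in R_s.    *)
Definition shiftw (s : nat) (w : Omega) : Omega := fun a => w (s :: a).

Section Rspaces.
Variable R : realType.
Variable p : R.
Variable lt : nat -> nat -> Prop.
Variable wf : well_founded lt.

Local Notation X := (set (seq nat) * set (Omega -> R))%type.

Definition Rbody (t : nat) (rec : forall s, lt s t -> X) : X :=
  match pselect (exists s, lt s t) with
  | right _ =>
      ([set [::]], [set f | Lsub p [set [::]] f /\ exists c : R, f = fun=> c])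
  | left _ =>
    match pselect (exists s, lt s t /\ forall u, lt u t -> u = s \/ lt u s)
    with
    | left h =>
        let s := projT1 (cid h) in
        let hs := proj1 (projT2 (cid h)) in
        let Is := (rec s hs).1 in
        let Rs := (rec s hs).2 in
        let I := [set a | a = [::] \/ exists2 a', Is a' & a = 0%N :: a'] in
        (I, [set g | Lsub p I g /\ exists b0 b1, [/\ Rs b0, Rs b1 &
              forall w, g w = if w [::] then b1 (shiftw 0 w)
                                         else b0 (shiftw 0 w)]])
    | right _ =>
        let I := [set a | exists s (h : lt s t),
                            exists2 a', (rec s h).1 a' & a = s :: a'] in
        (I, pclosure p (Lsub p I)
              (span [set g | exists s (h : lt s t),
                               exists2 f, (rec s h).2 f & g = f \o shiftw s]))
    end
  end.

Definition Rsys : nat -> X := Fix wf (fun _ => X) Rbody.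

Definition Icoord (t : nat) : set (seq nat) := (Rsys t).1.
Definition Rspace (t : nat) : set (Omega -> R) := (Rsys t).2.

End Rspaces.
Arguments Rsys {R} p {lt} wf.
Arguments Icoord {R} p {lt} wf t.
Arguments Rspace {R} p {lt} wf t.

(* Main.v *)
(** Each space is the closed span of the functions that depend on finitely many
   coordinates forming a chain for the prefix order on [seq nat], so the orthogonal
   projection onto it keeps the Walsh functions [r_A] with [A] a chain.  The prefix order
   is the intersection of two linear orders (lexicographic, siblings sorted upwards or
   downwards).  Split a function of finitely many coordinates into martingale differences
   [d_a] along the first order; the projection replaces [d_a] by its conditional
   expectation [E'_a d_a] along the second one.  For [p >= 2], put [m = p/2].  Three
   inequalities are combined:
   - the square function [S] of [f] satisfies [||S||_p <= sqrt m ||f||_p], because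
     [E S^p <= m E (S^(p-2) f^2)];
   - the dual Doob inequality [||sum E'_a (d_a^2)||_m <= m ||sum d_a^2||_m];
   - a martingale is controlled by its square function with constant [(p-1)^2 sqrt m].
   For [p < 2] argue by duality.  Infinitely many coordinates are reached by density of
   the functions of finitely many coordinates. *)

Require Import Defs.
From HB Require Import structures.
From mathcomp Require Import all_boot all_order all_algebra.
From mathcomp Require Import all_classical all_reals all_analysis.
From mathcomp Require Import measurable_realfun.
From mathcomp Require Import ring lra.
Set Implicit Arguments.
Unset Strict Implicit.
Unset Printing Implicit Defensive.
Import Order.TTheory GRing.Theory Num.Theory.
Import numFieldNormedType.Exports.
Local Open Scope classical_set_scope.
Local Open Scope ring_scope.

(** * Power inequalities *)

(** Functions of incomparable coordinates enter only through sums, so the closed span of the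
    functions of chains is in general not the range of a conditional expectation, and the averaging
    has to vary with [a]. A Walsh function [r_A] whose [lexL]-largest index is [a] occurs in [d_a]
    alone. Its [A] is a chain exactly when all its members are prefixes of [a], that is, when none
    of them is [lexR]-above [a] either; this is what [E'_a] selects. Two facts make the varying
    averages tractable. The flips commute, so [E'_a d_a] is still a martingale difference for
    [lexL], and the inequality between a martingale and its square function applies to it. The
    averages [E'_a] are nested along [lexR], which is all that the dual Doob inequality needs.
    Jensen's [(E'_a d_a)^2 <= E'_a (d_a^2)] joins the two. No constant depends on the number of
    coordinates, hence the passage to the limit. *)

Section PowerInequalities.
Context {R : realType}.
Implicit Types a b h m s u v x z d : R.

(** Young's inequality for the exponents [m] and [m / (m - 1)], multiplied by [m] so that it keeps a
    meaning at [m = 1], where the conjugate exponent is infinite. *)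
Lemma powR_young m a b : 1 <= m -> 0 <= a -> 0 <= b ->
  m * (a * b `^ (m - 1)) <= a `^ m + (m - 1) * b `^ m.
Proof.
move=> m1 a0 b0; have m0 : 0 < m by lra.
move: m1; rewrite le_eqVlt => /predU1P[<-|m1].
  by rewrite subrr powRr0 powRr1// mul0r mul1r mulr1 addr0.
have q0 : 0 < m / (m - 1) by rewrite divr_gt0// subr_gt0.
have := @conjugate_powR R a (b `^ (m - 1)) m (m / (m - 1)) a0 (powR_ge0 _ _) m0 q0.
rewrite -powRrM (_ : (m - 1) * (m / (m - 1)) = m); last by field; lra.
have -> : m^-1 + (m / (m - 1))^-1 = 1 by field; lra.
move=> /(_ erefl) H; rewrite -(ler_pM2l m0) in H; apply: (le_trans H).
rewrite le_eqVlt; apply/orP; left; apply/eqP; field; lra.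
Qed.

(** The tangent of the convex function [t^m] at [b] lies below the graph at [a]; algebraically a
    rearrangement of Young's inequality. *)
Lemma powR_tangent m a b : 1 <= m -> 0 <= a -> 0 <= b ->
  b `^ m - a `^ m <= m * (b `^ (m - 1) * (b - a)).
Proof.
move=> m1 a0 b0; have := powR_young m1 a0 b0.
by rewrite -(@mulr_powRB1 _ b m)//; [nra|lra].
Qed.

Lemma le_powR s a b : 0 <= s -> 0 <= a -> a <= b -> a `^ s <= b `^ s.
Proof. by move=> s0 a0 ab; apply: ge0_ler_powR; rewrite // nnegrE//; lra. Qed.

Lemma expR_trapezoid v : 0 <= v -> 2 * (expR v - 1) <= v * (expR v + 1).
Proof.
move=> v0.
pose f : R -> R := id * (expR + cst 1) - cst 2 * (expR : R -> R).
have df x : is_derive x (1 : R) f (expR x + 1 + x * expR x - 2 * expR x).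
  apply: is_derive_eq; rewrite /GRing.scale/= ?fctE; ring.
suff : f 0 <= f v by rewrite /f !fctE expR0; lra.
apply: (@ger0_derive1_ndecry R f 0) => //.
- move=> x; rewrite in_itv/= andbT => x0.
  rewrite derive1E (@derive_val _ _ _ _ _ _ _ (df x)).
  (* The derivative is [1 - (1 - x) exp x], nonnegative because [1 - x <= exp (- x)]. *)
  have := expR_ge1Dx (- x); have := expR_gt0 x; have := expRxMexpNx_1 x.
  by move=> h1 h2 h3; nra.
- apply: continuous_subspaceT => x; apply: differentiable_continuous.
  by apply/derivable1_diffP; exact: (@ex_derive _ _ _ _ _ _ _ (df x)).
Qed.

Lemma expR_sinh v : 0 <= v -> 2 * v <= expR v - expR (- v).
Proof.
move=> v0.
pose f : R -> R := (expR : R -> R) - (expR \o -%R) - cst 2 * (id : R -> R).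
have df x : is_derive x (1 : R) f (expR x + expR (- x) - 2).
  apply: is_derive_eq; rewrite /GRing.scale/= ?fctE; ring.
suff : f 0 <= f v by rewrite /f !fctE /= oppr0 expR0; lra.
apply: (@ger0_derive1_ndecry R f 0) => //.
- move=> x; rewrite in_itv/= andbT => x0.
  rewrite derive1E (@derive_val _ _ _ _ _ _ _ (df x)).
  by have := expR_ge1Dx x; have := expR_ge1Dx (- x); lra.
- apply: continuous_subspaceT => x; apply: differentiable_continuous.
  by apply/derivable1_diffP; exact: (@ex_derive _ _ _ _ _ _ _ (df x)).
Qed.

(* [b^s - a^s <= s ln(b/a) (a^s + b^s)/2] by the trapezoid rule for [exp], and
   [ln(b/a) <= (b - a)/sqrt(a b)]. *)
Lemma powR_diff s a b h : 0 <= s -> 0 < a -> a <= b -> 0 <= h -> h ^+ 2 <= a * b ->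
  2 * (h * (b `^ s - a `^ s)) <= s * ((b - a) * (a `^ s + b `^ s)).
Proof.
move=> s0 a0 ab h0 hab; have b0 : 0 < b by lra.
pose A := ln a; pose B := ln b.
have aE : a = expR A by rewrite lnK// posrE.
have bE : b = expR B by rewrite lnK// posrE.
have AB : A <= B by rewrite /A /B ler_ln ?posrE.
pose u := B - A; have u0 : 0 <= u by rewrite /u; lra.
have hu : h * u <= b - a.
  have := @expR_sinh (u / 2) (divr_ge0 u0 (ler0n _ 2)).
  rewrite mulrC divfK ?pnatr_eq0// => U.
  have hC : h <= expR ((A + B) / 2).
    rewrite -(@ler_sqr _ h) ?nnegrE ?expR_ge0// (le_trans hab)//.
    rewrite aE bE -expRD -expRM_natr.
    by rewrite (_ : (A + B) / 2 * 2%:R = A + B) ?lexx//; field.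
  rewrite (_ : b - a = expR ((A + B) / 2) * (expR (u / 2) - expR (- (u / 2)))).
    by have := expR_gt0 ((A + B) / 2); nra.
  rewrite mulrBr -!expRD [in LHS]aE [in LHS]bE /u.
  by congr (expR _ - expR _); field.
have dU : 2 * (b `^ s - a `^ s) <= s * u * (a `^ s + b `^ s).
  have -> : b `^ s = a `^ s * expR (s * u).
    by rewrite aE bE -!expRM -expRD /u; congr expR; ring.
  have := @expR_trapezoid (s * u) (mulr_ge0 s0 u0).
  by have := powR_gt0 s a0; nra.
have S0 : 0 <= a `^ s + b `^ s by rewrite addr_ge0 ?powR_ge0.
have H1 := ler_wpM2l h0 dU.
have H2 := ler_wpM2r S0 (ler_wpM2l s0 hu).
nra.
Qed.

(** [h^s] is at most the geometric mean of [a^s] and [b^s]. Convexity of [t^s] cannot serve instead,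
    since [s = m - 1] may be less than 1. *)
Lemma powR_midpoint s a b h : 0 <= s -> 0 <= a -> 0 <= b -> 0 <= h ->
  h ^+ 2 <= a * b -> 2 * h `^ s <= a `^ s + b `^ s.
Proof.
move=> s0 a0 b0 h0 hab.
have H : (h `^ s) ^+ 2 <= a `^ s * b `^ s.
  by rewrite expr2 -!powRM// -expr2; apply: le_powR => //; rewrite exprn_ge0.
have := powR_ge0 a s; have := powR_ge0 b s; have := powR_ge0 h s.
move: H; set X := h `^ s; set Y := a `^ s; set Z := b `^ s => H X0 Z0 Y0.
rewrite -ler_sqr ?nnegrE ?addr_ge0 ?mulr_ge0//.
by have := sqr_ge0 (Y - Z); nra.
Qed.

(* Bellman function for [E z^m <= m E (z^(m-1) x^2)], where [z] is the squared square
   function of the dyadic martingale [x]. *)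
Definition square_step m x z := z `^ m - m * (z `^ (m - 1) * x ^+ 2).

(** Averaging over the sign of [d] turns [x^2] into [x^2 + d^2]. The extra [m d^2 (z + d^2)^(m-1)]
    pays for the growth of [z^m] by the tangent at [z + d^2]; the rest is monotonicity of
    [t^(m-1)]. *)
Lemma square_step_le m x z d : 1 <= m -> 0 <= z ->
  (square_step m (x + d) (z + d ^+ 2) + square_step m (x - d) (z + d ^+ 2)) / 2
    <= square_step m x z.
Proof.
move=> m1 z0; rewrite /square_step.
have d0 := sqr_ge0 d.
have zd0 : 0 <= z + d ^+ 2 by lra.
have T := powR_tangent m1 z0 zd0.
have M : z `^ (m - 1) <= (z + d ^+ 2) `^ (m - 1) by apply: le_powR; lra.
move: T M; set Z := (z + d ^+ 2) `^ m; set Y := (z + d ^+ 2) `^ (m - 1).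
move=> T M; have := sqr_ge0 x => x0.
have N := ler_wpM2r x0 M.
have := @ler_wpM2l _ m _ _ _ N; nra.
Qed.

(* Bellman function for [E (x^2 + z)^m <= m (4m - 2) E (z (x^2 + z)^(m-1))]. *)
Definition martingale_step m x z :=
  (x ^+ 2 + z) `^ m - m * (4 * m - 2) * (z * (x ^+ 2 + z) `^ (m - 1)).

(** Let [h = x^2 + z], let [a] and [b] be its values after the two moves, and [s = m - 1]. Tangents
    at [a] and [b] bound the growth of the first term by [m (2 d^2 (a^s + b^s) + 2 x d (b^s -
    a^s))]. The cross term costs at most another [4 s d^2 (a^s + b^s)], and
    [2 + 4 (m - 1) = 4 m - 2] is the origin of the constant. The old [z] in the second term is
    handled by [powR_midpoint], as [h^2 <= a b]. *)
Lemma martingale_step_le m x z d : 1 <= m -> 0 <= z ->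
  (martingale_step m (x + d) (z + d ^+ 2)
     + martingale_step m (x - d) (z + d ^+ 2)) / 2 <= martingale_step m x z.
Proof.
move=> m1 z0.
wlog xd0 : d / 0 <= x * d.
  move=> W; have [/W//|xd] := lerP 0 (x * d).
  have := W (- d); rewrite mulrN oppr_ge0 sqrrN opprK [X in X / 2]addrC.
  by apply; exact: ltW.
rewrite /martingale_step.
set h := x ^+ 2 + z; set s := m - 1; set K := m * (4 * m - 2).
have d0 := sqr_ge0 d; have x0 := sqr_ge0 x.
set b := (x + d) ^+ 2 + (z + d ^+ 2); set a := (x - d) ^+ 2 + (z + d ^+ 2).
have s0 : 0 <= s by rewrite /s; lra.
have h0 : 0 <= h by rewrite /h; lra.
have a0 : 0 <= a by rewrite /a; have := sqr_ge0 (x - d); lra.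
have b0 : 0 <= b by rewrite /b; have := sqr_ge0 (x + d); lra.
have bE : b = h + 2 * d ^+ 2 + 2 * (x * d) by rewrite /b /h; ring.
have aE : a = h + 2 * d ^+ 2 - 2 * (x * d) by rewrite /a /h; ring.
have ab : a <= b by rewrite aE bE; lra.
have hab : h ^+ 2 <= a * b.
  rewrite aE bE (_ : _ * _ = h ^+ 2 + 4 * (h - x ^+ 2) * d ^+ 2 + 4 * d ^+ 4); last by ring.
  have : 0 <= h - x ^+ 2 by rewrite /h; lra.
  have : 0 <= d ^+ 4 by rewrite (_ : d ^+ 4 = (d ^+ 2) ^+ 2) ?sqr_ge0//; ring.
  nra.
have Ta := powR_tangent m1 h0 a0.
have Tb := powR_tangent m1 h0 b0.
have M := powR_midpoint s0 a0 b0 h0 hab.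
(* This is [powR_diff] with [b - a = 4 x d], multiplied by [x d]; then [x^2 <= h] cancels the factor
   [h]. The cases [d = 0] and [x = 0] are treated apart to have [a > 0] and [h > 0]. *)
have D : x * d * (b `^ s - a `^ s) <= 2 * s * d ^+ 2 * (a `^ s + b `^ s).
  have [->|dn0] := eqVneq d 0.
    by rewrite mulr0 mul0r expr0n/= mulr0 mul0r.
  have [->|xn0] := eqVneq x 0.
    rewrite !mul0r; apply: mulr_ge0; last by rewrite addr_ge0 ?powR_ge0.
    by apply: mulr_ge0 => //; apply: mulr_ge0.
  have hp : 0 < h by rewrite /h ltr_pwDl// exprn_even_gt0.
  have ap : 0 < a.
    by rewrite /a ltr_wpDl ?sqr_ge0// ltr_wpDl// exprn_even_gt0.
  have := powR_diff s0 ap ab h0 hab.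
  rewrite (_ : b - a = 4 * (x * d)); last by rewrite bE aE; ring.
  have S0 : 0 <= a `^ s + b `^ s by rewrite addr_ge0 ?powR_ge0.
  move=> P; rewrite -(ler_pM2l hp).
  have P2 := ler_wpM2l xd0 P.
  have xh : x ^+ 2 <= h by rewrite /h; lra.
  have Q : s * d ^+ 2 * (a `^ s + b `^ s) * x ^+ 2 <= s * d ^+ 2 * (a `^ s + b `^ s) * h.
    apply: ler_wpM2l => //; apply: mulr_ge0 => //.
    by apply: mulr_ge0.
  nra.
rewrite -/s in Ta Tb.
have E1 : b - h = 2 * d ^+ 2 + 2 * (x * d) by rewrite bE; ring.
have E2 : a - h = 2 * d ^+ 2 - 2 * (x * d) by rewrite aE; ring.
rewrite E1 in Tb; rewrite E2 in Ta.
have m0 : 0 <= m by lra.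
have D' := ler_wpM2l m0 D.
have K0 : 0 <= K * z by rewrite /K !mulr_ge0//; lra.
have M' := ler_wpM2l K0 M.
move: Ta Tb D' M'; rewrite /K /s.
set A := a `^ _; set B := b `^ _; set A1 := a `^ _; set B1 := b `^ _.
set H := h `^ _; set H1 := h `^ _ => Ta Tb D' M'.
nra.
Qed.

Lemma ln_le_sub1 a : 0 < a -> ln a <= a - 1.
Proof.
by move=> a0; have := expR_ge1Dx (ln a); rewrite lnK ?posrE//; lra.
Qed.

(* The squared constant is [m^3 (2m - 1)^4] with [m = p/2]; the square function and the
   averages use up [m] each, so [(2m - 1)^4 m] is left for the last step. *)
Lemma constant_comparison m : 1 <= m ->
  (m * (4 * m - 2)) `^ m - 1 <= ((2 * m - 1) ^+ 4 * m) `^ m.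
Proof.
move=> m1; pose e := m - 1; have e0 : 0 <= e by rewrite /e; lra.
have n0 : 0 < 2 * m - 1 by lra.
have n1 : 1 <= 2 * m - 1 by lra.
have m0 : 0 < m by lra.
pose A := (m * (2 * m - 1)) `^ m.
have A0 : 0 <= A by rewrite powR_ge0.
rewrite (_ : m * (4 * m - 2) = 2 * (m * (2 * m - 1))); last by ring.
rewrite powRM ?mulr_ge0 ?(ltW n0) ?(ltW m0)// -/A.
rewrite (_ : (2 * m - 1) ^+ 4 * m = (2 * m - 1) ^+ 3 * (m * (2 * m - 1))); last by ring.
rewrite powRM ?mulr_ge0 ?exprn_ge0 ?(ltW n0) ?(ltW m0)// -/A.
suff : A * (2 `^ m - ((2 * m - 1) ^+ 3) `^ m) <= 1 by lra.
have n3 : 1 + 6 * e <= ((2 * m - 1) ^+ 3) `^ m.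
  apply: (@le_trans _ _ ((2 * m - 1) ^+ 3)).
    have -> : (2 * m - 1) ^+ 3 = 1 + 6 * e + 12 * e ^+ 2 + 8 * (e * e ^+ 2).
      by rewrite /e; ring.
    by have := sqr_ge0 e; nra.
  by apply: le1r_powR => //; rewrite exprn_ege1.
(* At [m = 1] both sides are equal, so small [e] needs first-order estimates. From [e = 1/4] on,
   [(2 m - 1)^3 >= 2] makes the left side nonpositive. *)
have [e4|e4] := leP 4^-1 e.
  suff : 2 `^ m <= ((2 * m - 1) ^+ 3) `^ m by nra.
  apply: le_powR => //; first lra.
  have -> : (2 * m - 1) ^+ 3 = 1 + 6 * e + 12 * e ^+ 2 + 8 * (e * e ^+ 2).
    by rewrite /e; ring.
  by have := sqr_ge0 e; nra.
have two : 2 `^ m <= 2 + 2 * e.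
  have -> : m = 1 + e by rewrite /e; ring.
  rewrite powRD ?pnatr_eq0 ?implybT// powRr1//.
  rewrite (_ : 2 + 2 * e = 2 * (1 + e)); last by ring.
  rewrite ler_pM2l//; move: e0; rewrite le_eqVlt => /predU1P[<-|ep].
    by rewrite powRr0 addr0.
  (* Bernoulli's [2^e <= 1 + e], as Young's inequality for the exponents [1/e] and [1/(1 - e)]. *)
  have := @conjugate_powR R (2 `^ e) 1 e^-1 (1 - e)^-1 (powR_ge0 _ _) ler01.
  rewrite -powRrM mulfV ?gt_eqF// powRr1// powR1 !invrK mulr1 mul1r.
  rewrite !invr_gt0 (_ : e + (1 - e) = 1); last by ring.
  move=> /(_ ep); have e1 : 0 < 1 - e by lra.
  by move=> /(_ e1 erefl); lra.
(* [ln m <= e] and [ln (2 m - 1) <= 2 e] give the exponent [3 e m], which is at most [4 e] because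
   [m <= 5/4]. *)
have AE : A <= expR (4 * e).
  rewrite /A /powR mulf_eq0 !gt_eqF//= ler_expR lnM ?posrE//.
  have L1 := ln_le_sub1 m0; have L2 := ln_le_sub1 n0.
  have -> : 4 * e = (1 + 4^-1) * (4 * e) * (4 / 5) by field.
  have : m <= 1 + 4^-1 by rewrite /e in e4; lra.
  rewrite /e in e4 e0 *; nra.
have E : expR (4 * e) * (1 - 4 * e) <= 1.
  have := expR_ge1Dx (- (4 * e)); have := expRxMexpNx_1 (4 * e).
  by have := expR_gt0 (4 * e); nra.
apply: le_trans E; apply: (@le_trans _ _ (A * (1 - 4 * e))).
  by apply: ler_wpM2l => //; lra.
by apply: ler_wpM2r => //; lra.
Qed.

End PowerInequalities.

(** * Averaging over coordinates *)

Definition flip (a : seq nat) (w : Omega) : Omega :=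
  fun b => if b == a then ~~ w b else w b.

Lemma flipK a : involutive (flip a).
Proof. by move=> w; apply/funext => b; rewrite /flip; case: eqP => // _; rewrite negbK. Qed.

Lemma flipC a b w : flip a (flip b w) = flip b (flip a w).
Proof. by apply/funext => c; rewrite /flip; case: eqP; case: eqP. Qed.

Section Averaging.
Context {R : realType}.
Implicit Types (f g : Omega -> R) (a b : seq nat) (s T : seq (seq nat)) (w : Omega).

Definition flip_inv a f := forall w, f (flip a w) = f w.

(** Conditional expectation given all coordinates but [a], written with a flip so that it makes
    sense pointwise and without integrability. *)
Definition avg1 a f : Omega -> R := fun w => (f w + f (flip a w)) / 2.

Definition avg s f : Omega -> R := foldr avg1 f s.

Lemma avg1_inv a f : flip_inv a (avg1 a f).
Proof. by move=> w; rewrite /avg1 flipK addrC. Qed.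

Lemma flip_inv_avg1 a b f : flip_inv b f -> flip_inv b (avg1 a f).
Proof. by move=> bf w; rewrite /avg1 bf flipC bf. Qed.

Lemma avg1_id a f : flip_inv a f -> avg1 a f = f.
Proof. by move=> af; apply/funext => w; rewrite /avg1 af; field. Qed.

Lemma avg1_flip a b f : avg1 a f \o flip b = avg1 a (f \o flip b).
Proof. by apply/funext => w; rewrite /avg1 /= flipC. Qed.

Lemma avg1C a b f : avg1 a (avg1 b f) = avg1 b (avg1 a f).
Proof. by apply/funext => w; rewrite /avg1 flipC; field. Qed.

Lemma avg_avg1 s a f : avg s (avg1 a f) = avg1 a (avg s f).
Proof. by elim: s => //= b s ->; rewrite avg1C. Qed.

Lemma flip_inv_avg s b f : flip_inv b f -> flip_inv b (avg s f).
Proof. by move=> bf; elim: s => //= a s IH; exact: flip_inv_avg1. Qed.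

Lemma avg_inv s a f : a \in s -> flip_inv a (avg s f).
Proof.
elim: s => //= b s IH; rewrite inE => /orP[/eqP->|/IH]; first exact: avg1_inv.
exact: flip_inv_avg1.
Qed.

Lemma avg_id s f : (forall a, a \in s -> flip_inv a f) -> avg s f = f.
Proof.
elim: s => //= b s IH H; rewrite IH => [|a as_]; last by apply: H; rewrite inE as_ orbT.
by apply: avg1_id; apply: H; rewrite mem_head.
Qed.

Lemma avg_flip s b f : avg s f \o flip b = avg s (f \o flip b).
Proof. by elim: s => //= a s IH; rewrite avg1_flip IH. Qed.

Lemma avgD s f g : avg s (fun w => f w + g w) = fun w => avg s f w + avg s g w.
Proof.
by elim: s => //= a s ->; apply/funext => w; rewrite /avg1; field.
Qed.

Lemma avgZ s c f : avg s (fun w => c * f w) = fun w => c * avg s f w.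
Proof.
by elim: s => //= a s ->; apply/funext => w; rewrite /avg1; field.
Qed.

Lemma avgM s f g : (forall a, a \in s -> flip_inv a g) ->
  avg s (fun w => f w * g w) = fun w => avg s f w * g w.
Proof.
elim: s => //= a s IH H; rewrite IH => [|b bs]; last by apply: H; rewrite inE bs orbT.
by apply/funext => w; rewrite /avg1 H ?mem_head//; field.
Qed.

Lemma avg_le s f g : (forall w, f w <= g w) -> forall w, avg s f w <= avg s g w.
Proof.
by move=> fg; elim: s => //= a s IH w; rewrite /avg1 ler_pM2r// lerD.
Qed.

Lemma avg_sqr_le s f w : avg s f w ^+ 2 <= avg s (fun w => f w ^+ 2) w.
Proof.
elim: s w => //= a s IH w; rewrite /avg1.
have := IH w; have := IH (flip a w).
by have := sqr_ge0 (avg s f w - avg s f (flip a w)); nra.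
Qed.

(** If [f] depends on [T] only, [avg T f] is constant, so the base point does not matter and this is
    the integral of [f] ([integral_cylinder]). *)
Definition expect T f : R := avg T f (fun=> false).

Lemma expectD T f g : expect T (fun w => f w + g w) = expect T f + expect T g.
Proof. by rewrite /expect avgD. Qed.

Lemma expectZ T c f : expect T (fun w => c * f w) = c * expect T f.
Proof. by rewrite /expect avgZ. Qed.

Lemma expectB T f g : expect T (fun w => f w - g w) = expect T f - expect T g.
Proof.
rewrite -[- _]mulN1r -expectZ -expectD; congr expect.
by apply/funext => w; rewrite mulN1r.
Qed.

Lemma expect_cst T (c : R) : expect T (fun=> c) = c.
Proof. by rewrite /expect avg_id. Qed.

Lemma expect_le T f g : (forall w, f w <= g w) -> expect T f <= expect T g.
Proof. by move=> fg; exact: avg_le. Qed.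

Lemma expect_ge0 T f : (forall w, 0 <= f w) -> 0 <= expect T f.
Proof. by move=> f0; rewrite -(expect_cst T 0); exact: expect_le. Qed.

Lemma expect_sum T (I : Type) (s : seq I) (F : I -> Omega -> R) :
  expect T (fun w => \sum_(i <- s) F i w) = \sum_(i <- s) expect T (F i).
Proof.
elim: s => [|i s IH]; first by under eq_fun do rewrite big_nil; rewrite expect_cst big_nil.
by under eq_fun do rewrite big_cons; rewrite expectD IH big_cons.
Qed.

Lemma expect_avg1 T a f : a \in T -> expect T (avg1 a f) = expect T f.
Proof. by move=> aT; rewrite /expect avg_avg1 avg1_id//; exact: avg_inv. Qed.

Lemma expect_avg T s f : {subset s <= T} -> expect T (avg s f) = expect T f.
Proof.
elim: s => //= a s IH sT; rewrite expect_avg1 ?sT ?mem_head// IH// => b bs.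
by rewrite sT// inE bs orbT.
Qed.

Lemma expect_avgM T s f g : {subset s <= T} -> (forall a, a \in s -> flip_inv a g) ->
  expect T (fun w => avg s f w * g w) = expect T (fun w => f w * g w).
Proof. by move=> sT gs; rewrite -avgM// expect_avg. Qed.

Lemma expect_antisym T a f : a \in T -> (forall w, f (flip a w) = - f w) ->
  expect T f = 0.
Proof.
move=> aT af; rewrite -(expect_avg1 _ aT) -[RHS](expect_cst T); congr expect.
by apply/funext => w; rewrite /avg1 af subrr mul0r.
Qed.

Lemma flip_inv_agree s f w w' : (forall a, a \in s -> flip_inv a f) ->
  (forall b, b \notin s -> w b = w' b) -> f w = f w'.
Proof.
elim: s w => [|a s IH] w H ww'; first by congr f; apply/funext => b; exact: ww'.
have Hs b : b \in s -> flip_inv b f by move=> bs; apply: H; rewrite inE bs orbT.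
have [e|e] := eqVneq (w a) (w' a).
  apply: IH => // b bs; have [->//|ba] := eqVneq b a.
  by apply: ww'; rewrite inE negb_or ba.
rewrite -(H a (mem_head _ _) w); apply: IH => // b bs; rewrite /flip.
have [->|ba] := eqVneq b a; first by move: e; case: (w a); case: (w' a).
by apply: ww'; rewrite inE negb_or ba.
Qed.

Lemma depends_on_flip (I : set (seq nat)) f a : depends_on I f -> ~ I a -> flip_inv a f.
Proof.
by move=> If Ia w; apply: If => b Ib; rewrite /flip; case: eqP => // ba; rewrite ba in Ib.
Qed.

(** Invariance under single flips controls only finitely many coordinates at a time; the finite list
    [T] leaves just the members of [T] outside [I] to be removed. *)
Lemma depends_on_sub (T : seq (seq nat)) (I : set (seq nat)) f :
  depends_on [set` T] f -> (forall a, a \in T -> ~ I a -> flip_inv a f) ->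
  depends_on I f.
Proof.
move=> Tf H w w' ww'.
pose v : Omega := fun b => if b \in T then w' b else w b.
have -> : f w' = f v by apply: Tf => b; rewrite /v/= => ->.
apply: (@flip_inv_agree [seq b <- T | ~~ `[< I b >]]).
  by move=> a; rewrite mem_filter => /andP[/asboolPn Ia aT]; exact: H.
move=> b; rewrite mem_filter negb_and negbK /v.
by move=> /orP[/asboolP/ww'->|/negbTE->//]; case: ifP.
Qed.

Lemma depends_on_avg (I : set (seq nat)) s f : depends_on I f -> depends_on I (avg s f).
Proof.
move=> If; elim: s => //= a s IH w w' ww'; rewrite /avg1 (IH _ _ ww').
by congr ((_ + _) / 2); apply: IH => b Ib; rewrite /flip ww'.
Qed.

End Averaging.

(** * Inequalities for finite martingales *)

Section FiniteMartingales.
Context {R : realType}.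
Implicit Types (T ks : seq (seq nat)) (x z : Omega -> R) (d g : seq nat -> Omega -> R).

(* Induction along the martingale: averaging over the newest coordinate turns the
   pointwise inequality for [Phi] into monotonicity of its expectation. *)
Lemma expect_bellman (Phi : R -> R -> R) (r : rel (seq nat)) T ks d x z :
  (forall x z d : R, 0 <= z ->
     (Phi (x + d) (z + d ^+ 2) + Phi (x - d) (z + d ^+ 2)) / 2 <= Phi x z) ->
  {subset ks <= T} -> pairwise r ks ->
  (forall i, i \in ks -> flip_inv i x) -> (forall i, i \in ks -> flip_inv i z) ->
  (forall w, 0 <= z w) ->
  (forall i w, d i (flip i w) = - d i w) ->
  (forall j i, i \in ks -> r j i -> flip_inv i (d j)) ->
  expect T (fun w => Phi (x w + \sum_(k <- ks) d k w)
                         (z w + \sum_(k <- ks) d k w ^+ 2))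
    <= expect T (fun w => Phi (x w) (z w)).
Proof.
move=> step; elim: ks x z => [|k ks IH] x z ksT.
  by move=> _ _ _ _ _ _; under eq_fun do rewrite !big_nil !addr0.
rewrite pairwise_cons => /andP[/allP rk rks] xi zi z0 da di.
have kks : {subset ks <= k :: ks} by move=> i iks; rewrite inE iks orbT.
under eq_fun do rewrite !big_cons !addrA.
apply: (le_trans (IH (fun w => x w + d k w) (fun w => z w + d k w ^+ 2) _ _ _ _ _ _ _)) => //.
- by move=> i /kks; exact: ksT.
- by move=> i iks w; rewrite xi ?kks// di ?rk ?kks.
- by move=> i iks w; rewrite zi ?kks// di ?rk ?kks.
- by move=> w; rewrite addr_ge0// sqr_ge0.
- by move=> j i iks; apply: di; rewrite kks.
rewrite -(@expect_avg1 _ T k) ?ksT ?mem_head//; apply: expect_le => w.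
rewrite /avg1 xi ?mem_head// zi ?mem_head// da sqrrN; exact: step.
Qed.

(* Dual form of Doob's inequality, for the decreasing family of averages [avg (N k)]. *)
Lemma expect_stein (m : R) (r : rel (seq nat)) (N : seq nat -> seq (seq nat)) T ks g x :
  1 <= m -> pairwise r ks ->
  (forall k, k \in ks -> {subset N k <= T}) ->
  (forall j k, k \in ks -> r j k -> {subset N k <= N j}) ->
  (forall k w, 0 <= g k w) -> (forall w, 0 <= x w) ->
  (forall k b, k \in ks -> b \in N k -> flip_inv b x) ->
  expect T (fun w => (x w + \sum_(k <- ks) avg (N k) (g k) w) `^ m) <=
  expect T (fun w => x w `^ m) +
  m * expect T (fun w => (x w + \sum_(k <- ks) avg (N k) (g k) w) `^ (m - 1)
                         * \sum_(k <- ks) g k w).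
Proof.
move=> m1 + + + g0; elim: ks x => [|k ks IH] x.
  move=> _ _ _ _ _; under [X in _ <= _ + _ * expect T X]eq_fun do rewrite !big_nil mulr0.
  rewrite expect_cst mulr0 addr0.
  by under eq_fun do rewrite big_nil addr0.
rewrite pairwise_cons => /andP[/allP rk rks] NT Nr x0 xi.
have kks : {subset ks <= k :: ks} by move=> i iks; rewrite inE iks orbT.
have e0 i w : 0 <= avg (N i) (g i) w.
  by have := @avg_le _ (N i) (fun=> 0) (g i) (g0 i) w; rewrite avg_id.
pose x' w := x w + avg (N k) (g k) w.
have x'0 w : 0 <= x' w by rewrite addr_ge0.
have XE w : x w + \sum_(i <- k :: ks) avg (N i) (g i) w =
    x' w + \sum_(i <- ks) avg (N i) (g i) w by rewrite big_cons addrA.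
under eq_fun do rewrite XE.
under [X in _ <= _ + _ * expect T X]eq_fun do rewrite XE.
apply: (le_trans (IH x' rks _ _ _ _)) => //.
- by move=> i /kks; exact: NT.
- by move=> j i /kks; exact: Nr.
- move=> i b iks bN w; rewrite /x' (xi i)//; last exact: kks.
  by rewrite (avg_inv _ (Nr k i (kks _ iks) (rk i iks) b bN)).
set Y := fun w => (x' w + \sum_(i <- ks) avg (N i) (g i) w) `^ (m - 1).
have -> : expect T (fun w => Y w * \sum_(i <- k :: ks) g i w) =
    expect T (fun w => Y w * g k w) + expect T (fun w => Y w * \sum_(i <- ks) g i w).
  by rewrite -expectD; congr expect; apply/funext => w; rewrite big_cons mulrDr.
suff : expect T (fun w => x' w `^ m) <=
    expect T (fun w => x w `^ m) + m * expect T (fun w => Y w * g k w) by lra.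
have -> : expect T (fun w => x w `^ m) + m * expect T (fun w => Y w * g k w) =
    expect T (fun w => x w `^ m + m * (Y w * g k w)) by rewrite expectD expectZ.
(* The tangent is taken at [x'] because [x'^(m-1)] is invariant under the flips in [N k], so the
   average can be moved off [g k]. Only then is [x'] enlarged to the full sum. *)
apply: (@le_trans _ _ (expect T (fun w => x w `^ m +
    m * (avg (N k) (g k) w * x' w `^ (m - 1))))).
  apply: expect_le => w.
  have := powR_tangent m1 (x0 w) (x'0 w).
  by rewrite (_ : x' w - x w = avg (N k) (g k) w) /x'; [lra|ring].
rewrite !expectD lerD2l !expectZ expect_avgM; last 2 first.
- by apply: NT; rewrite mem_head.
- by move=> b bN w; rewrite /x' (xi k) ?mem_head// (avg_inv _ bN).
apply: ler_wpM2l; first lra.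
apply: expect_le => w; rewrite mulrC; apply: ler_wpM2r => //.
apply: le_powR => //; first lra.
by rewrite lerDl sumr_ge0.
Qed.

(** Young's inequality applied to [c Z] and [Y] produces [(m - 1) E Y^m], which is subtracted from
    the left; all expectations here are real numbers, so this is legitimate. *)
Lemma expect_absorb (m c : R) T (Y Z : Omega -> R) : 1 <= m -> 0 <= c ->
  (forall w, 0 <= Y w) -> (forall w, 0 <= Z w) ->
  expect T (fun w => Y w `^ m) <= c * expect T (fun w => Y w `^ (m - 1) * Z w) ->
  expect T (fun w => Y w `^ m) <= c `^ m * expect T (fun w => Z w `^ m).
Proof.
move=> m1 c0 Y0 Z0 H.
have : m * expect T (fun w => Y w `^ m) <=
    c `^ m * expect T (fun w => Z w `^ m) + (m - 1) * expect T (fun w => Y w `^ m).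
  rewrite -!expectZ -expectD.
  apply: (@le_trans _ _ (m * (c * expect T (fun w => Y w `^ (m - 1) * Z w)))).
    by rewrite expectZ ler_wpM2l//; lra.
  rewrite -!expectZ; apply: expect_le => w.
  rewrite -powRM//.
  have := @powR_young _ m (c * Z w) (Y w) m1 (mulr_ge0 c0 (Z0 w)) (Y0 w).
  by rewrite -mulrA (mulrC (Z w)).
lra.
Qed.

End FiniteMartingales.

(** * Projection onto functions of chains *)

Definition lexL (a b : seq nat) : bool := ((a : seqlexi nat) < b)%O.
Definition lexR (a b : seq nat) : bool := ((a : seqlexi nat^d) < b)%O.

Lemma prefix_lexL a b : prefix a b -> ~~ lexL b a.
Proof.
rewrite /lexL -leNgt; elim: a b => [|x a IH] [|y b]//=.
by move=> /andP[/eqP-> /IH ab]; rewrite lexi_cons lexx/=.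
Qed.

Lemma prefix_lexR a b : prefix a b -> ~~ lexR b a.
Proof.
rewrite /lexR -leNgt; elim: a b => [|x a IH] [|y b]//=.
by move=> /andP[/eqP-> /IH ab]; rewrite lexi_cons lexx/=.
Qed.

Lemma lexLR_prefix a b : ~~ lexL b a -> ~~ lexR b a -> prefix a b.
Proof.
rewrite /lexL /lexR -!leNgt; elim: a b => [|x a IH] [|y b]//=.
rewrite !lexi_cons => /andP[xy h1] /andP[yx h2].
have e : x = y by apply/eqP; rewrite eq_le xy.
by subst y; rewrite eqxx/= IH//; [move: h1|move: h2]; rewrite lexx.
Qed.

Lemma prefix_comparable (a b c : seq nat) :
  prefix b a -> prefix c a -> prefix b c || prefix c b.
Proof.
elim: a b c => [|x a IH] [|y b] [|z c]//=.
move=> /andP[/eqP-> ba] /andP[/eqP-> ca]; rewrite eqxx/=; exact: IH.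
Qed.

Lemma lexL_irr a : lexL a a = false. Proof. exact: ltxx. Qed.
Lemma lexR_trans : transitive lexR. Proof. move=> b a c; rewrite /lexR /lexL; exact: lt_trans. Qed.
Lemma lexL_trans : transitive lexL. Proof. move=> b a c; rewrite /lexR /lexL; exact: lt_trans. Qed.
Lemma lexL_asym a b : lexL a b -> lexL b a = false.
Proof. by move=> ab; apply/negbTE; rewrite -leNgt ltW. Qed.
Lemma lexL_total a b : [|| lexL a b, a == b | lexL b a].
Proof. by rewrite /lexL; case: ltgtP. Qed.

Lemma lexL_sort (s : seq (seq nat)) :
  exists2 t, pairwise lexL t & t =i s.
Proof.
exists (sort (<=%O : rel (seqlexi nat)) (undup s)); last first.
  by move=> a; rewrite mem_sort mem_undup.
rewrite -(sorted_pairwise lexL_trans).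
by have := sort_lt_sorted (undup s : seq (seqlexi nat)); rewrite undup_uniq.
Qed.

Lemma lexR_sort (s : seq (seq nat)) : uniq s ->
  exists2 t, pairwise lexR t & perm_eq t s.
Proof.
move=> us; exists (sort (<=%O : rel (seqlexi nat^d)) s); last by rewrite perm_sort.
rewrite -(sorted_pairwise lexR_trans).
by have := sort_lt_sorted (s : seq (seqlexi nat^d)); rewrite us.
Qed.

(* The conditional expectations along two linear extensions [lexL], [lexR] of the
   prefix order whose intersection is the prefix order: the [lexL]-martingale difference
   at [a], averaged along [lexR], only depends on the prefixes of [a]. *)
Section ChainProjection.
Context {R : realType}.
Variables (J : set (seq nat)) (T : seq (seq nat)) (f : Omega -> R).
Hypothesis lexLT : pairwise lexL T.
Hypothesis fT : depends_on [set` T] f.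

Definition above1 a := [seq b <- T | lexL a b].
(** Coordinates outside [J] are averaged out too, since chains must lie in [J]. If [a] in [T] is
    itself outside [J], this makes [pdiff a] vanish. *)
Definition above2 a := [seq b <- T | ~~ `[< J b >] || lexR a b].
Definition mdiff a : Omega -> R := fun w => avg (above1 a) f w - avg1 a (avg (above1 a) f) w.
Definition pdiff a : Omega -> R := avg (above2 a) (mdiff a).
Definition chain_proj : Omega -> R := fun w => expect T f + \sum_(a <- T) pdiff a w.

Let above2T a : {subset above2 a <= T}.
Proof. by move=> b; rewrite mem_filter => /andP[]. Qed.

Lemma mdiff_flip a w : mdiff a (flip a w) = - mdiff a w.
Proof. by rewrite /mdiff avg1_inv /avg1; field. Qed.

Lemma mdiff_inv a b : b \in T -> lexL a b -> flip_inv b (mdiff a).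
Proof.
move=> bT ab w; have H : flip_inv b (avg (above1 a) f).
  by apply: avg_inv; rewrite mem_filter ab.
by rewrite /mdiff H (flip_inv_avg1 _ H).
Qed.

Lemma pdiff_flip a w : pdiff a (flip a w) = - pdiff a w.
Proof.
have : pdiff a \o flip a = fun w => -1 * pdiff a w.
  rewrite /pdiff avg_flip -avgZ; congr avg.
  by apply/funext => v /=; rewrite mdiff_flip mulN1r.
by move=> /(congr1 (@^~ w)) /=; rewrite mulN1r.
Qed.

Lemma pdiff_inv a b : b \in T -> lexL a b -> flip_inv b (pdiff a).
Proof. by move=> bT ab; apply: flip_inv_avg; exact: mdiff_inv. Qed.

Lemma mdiff_depends a : depends_on [set` T] (mdiff a).
Proof.
move=> w w' ww'; rewrite /mdiff.
have H := depends_on_avg (above1 a) fT.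
by congr (_ - _); [exact: H|exact: (depends_on_avg [:: a] H ww')].
Qed.

Lemma pdiff_depends a : depends_on [set b | [/\ b \in T, J b & prefix b a]] (pdiff a).
Proof.
apply: (@depends_on_sub _ T); first exact/depends_on_avg/mdiff_depends.
move=> b bT /= nb.
have [l1|l1] := boolP (lexL a b); first exact: pdiff_inv.
apply: avg_inv; rewrite mem_filter bT andbT.
apply/orP; have [Jb|] := asboolP (J b); [right|by left].
by apply: contrapT => /negP l2; apply: nb; split => //; exact: lexLR_prefix.
Qed.

(** Telescoping along the sorted list. The induction runs over sorted lists [s] that need not be
    [T]: at the head everything else is above, and the head is above nothing. *)
Lemma mdiff_sum w : f w = expect T f + \sum_(a <- T) mdiff a w.
Proof.
have -> : expect T f = avg T f w.
  have D : depends_on set0 (avg T f).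
    apply: (@depends_on_sub _ T); first exact: depends_on_avg.
    by move=> a aT _; exact: avg_inv.
  exact: D.
suff H s : pairwise lexL s -> f w = avg s f w +
    \sum_(a <- s) (avg [seq b <- s | lexL a b] f w -
      avg1 a (avg [seq b <- s | lexL a b] f) w) by exact: H.
elim: s => [|a s IH] /=; first by rewrite big_nil addr0.
move=> /andP[/allP as_ ps]; rewrite {1}(IH ps) big_cons lexL_irr.
have -> : [seq b <- s | lexL a b] = s by apply/all_filterP/allP.
rewrite [in RHS]addrA [X in _ = X + _](_ : _ = avg s f w); last by ring.
congr (_ + _); apply: eq_big_seq => b /as_ ab; by rewrite lexL_asym.
Qed.

(** For each [a], first average out of [u] the coordinates [B] that [mdiff a - pdiff a] does not
    see. If [a] is not in [C], the product changes sign under the flip of [a]. If [a] is in [C], the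
    averaged [u] is invariant under [above2 a], so that [pdiff a] may be replaced by [mdiff a]: a
    member of the chain [C] that is [lexR]-above [a] extends [a], hence is also [lexL]-above [a] and
    lies in [B]. *)
Lemma chain_proj_orth S (C : seq (seq nat)) (u : Omega -> R) :
  {subset T <= S} -> {subset C <= S} -> (forall b, b \in C -> J b) ->
  (forall a b, a \in C -> b \in C -> prefix a b || prefix b a) ->
  depends_on [set` C] u ->
  expect S (fun w => (f w - chain_proj w) * u w) = 0.
Proof.
move=> TS CS CJ Cch uC.
have -> : (fun w => (f w - chain_proj w) * u w) =
    (fun w => \sum_(a <- T) (mdiff a w - pdiff a w) * u w).
  apply/funext => w; rewrite -mulr_suml; congr (_ * _).
  by rewrite sumrB /chain_proj [f w in LHS]mdiff_sum; ring.
rewrite expect_sum big_seq big1// => a aT.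
pose B := [seq b <- S | (b \notin T) || lexL a b].
have BS : {subset B <= S} by move=> b; rewrite mem_filter => /andP[].
have inB (g : Omega -> R) b : depends_on [set` T] g -> (forall b, b \in T -> lexL a b -> flip_inv b g) ->
    b \in B -> flip_inv b g.
  move=> gT gi; rewrite mem_filter => /andP[/orP[/negP bT _|ab bS]].
    exact: depends_on_flip gT bT.
  have [bT|/negP bT] := boolP (b \in T); first exact: gi.
  exact: depends_on_flip gT bT.
have notC b : b \notin C -> flip_inv b (avg B u).
  by move=> /negP bC; apply: flip_inv_avg; exact: depends_on_flip uC bC.
have DB b : b \in B -> flip_inv b (fun w => mdiff a w - pdiff a w).
  move=> bB w; rewrite (inB (mdiff a) b) ?(inB (pdiff a) b)//.
  - exact/depends_on_avg/mdiff_depends.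
  - by move=> c cT ac; exact: pdiff_inv.
  - exact: mdiff_depends.
  - by move=> c cT ac; exact: mdiff_inv.
under eq_fun do rewrite mulrC.
rewrite -(expect_avgM _ BS)//.
have [aC|aC] := boolP (a \in C); last first.
  apply: (@expect_antisym _ _ a); first exact: TS.
  by move=> w; rewrite notC// mdiff_flip pdiff_flip; ring.
under eq_fun do rewrite mulrC mulrBl.
rewrite expectB expect_avgM ?subrr//; first by move=> b /above2T /TS.
move=> b; rewrite mem_filter => /andP[Jab bT].
have [bC|] := boolP (b \in C); last exact: notC.
move: Jab; rewrite asboolT/=; last exact: CJ.
move=> ab; apply: avg_inv; rewrite mem_filter TS// andbT; apply/orP; right.
have /orP[p|p] := Cch a b aC bC; last by have := prefix_lexR p; rewrite ab.
have := prefix_lexL p; have := lexL_total a b; move=> /or3P[->//|/eqP e|->//].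
by move: ab; rewrite e /lexR ltxx.
Qed.

Section Bound.
Variable m : R.
Hypothesis m1 : 1 <= m.

Let x0 := expect T f.
(** The squared mean counts as a first increment; with this start both Bellman functions have a
    nonpositive initial value. *)
Let z0 := x0 ^+ 2.
Let z w := z0 + \sum_(a <- T) mdiff a w ^+ 2.
Let z2 w := z0 + \sum_(a <- T) pdiff a w ^+ 2.
Let X w := z0 + \sum_(a <- T) avg (above2 a) (fun w => mdiff a w ^+ 2) w.

Let z00 : 0 <= z0. Proof. exact: sqr_ge0. Qed.
Let z_ge0 w : 0 <= z w.
Proof. by rewrite addr_ge0// sumr_ge0// => a _; exact: sqr_ge0. Qed.
Let z2_ge0 w : 0 <= z2 w.
Proof. by rewrite addr_ge0// sumr_ge0// => a _; exact: sqr_ge0. Qed.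
Let z2X w : z2 w <= X w.
Proof. by rewrite lerD2l ler_sum// => a _; exact: avg_sqr_le. Qed.
Let X_ge0 w : 0 <= X w. Proof. exact: le_trans (z2X w). Qed.
Let m0 : 0 <= m. Proof. exact: le_trans ler01 m1. Qed.
Let m_ge1 : 0 <= m - 1. Proof. by rewrite subr_ge0. Qed.

Lemma square_function_le : expect T (fun w => z w `^ m) <=
  m `^ m * expect T (fun w => (f w ^+ 2) `^ m).
Proof.
have m1' := m1.
apply: expect_absorb => //; first by move=> w; exact: sqr_ge0.
have := @expect_bellman R (square_step m) lexL T T mdiff (fun=> x0) (fun=> z0).
move=> /(_ (fun x z d => @square_step_le R m x z d m1) (fun _ => id) lexLT).
move=> /(_ (fun _ _ _ => erefl) (fun _ _ _ => erefl) (fun=> z00) mdiff_flip).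
move=> /(_ (fun j i => @mdiff_inv j i)).
rewrite expect_cst /square_step -/(z _).
under eq_fun do rewrite -mdiff_sum.
rewrite expectB expectZ -/z -/z0 [z0 `^ (m - 1) * z0]mulrC mulr_powRB1//; last lra.
have := powR_ge0 z0 m; nra.
Qed.

(** The sets [above2 k] decrease along [lexR], not along [lexL], so the sum is re-sorted before
    [expect_stein] applies. *)
Lemma stein_le : expect T (fun w => X w `^ m) <= m `^ m * expect T (fun w => z w `^ m).
Proof.
have m1' := m1.
apply: expect_absorb => //.
have uT : uniq T by apply: pairwise_uniq lexLT => a; exact: lexL_irr.
have [T2 p2 pe] := lexR_sort uT.
have T2T : T2 =i T by exact: perm_mem.
have XE w : X w = z0 + \sum_(k <- T2) avg (above2 k) (fun w => mdiff k w ^+ 2) w.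
  by rewrite /X (perm_big _ pe).
have N2 j k : k \in T2 -> lexR j k -> {subset above2 k <= above2 j}.
  move=> kT jk b; rewrite !mem_filter => /andP[/orP[->//|kb] ->]; rewrite andbT.
  by rewrite (lexR_trans jk kb) orbT.
under eq_fun do rewrite XE.
apply: (le_trans (@expect_stein R m lexR above2 T T2 (fun a w => mdiff a w ^+ 2)
  (fun=> z0) m1 p2 (fun k _ => @above2T k) N2 _ _ _)) => //.
  by move=> k w; exact: sqr_ge0.
rewrite -!expectZ -expectD; apply: expect_le => w.
rewrite -XE; have -> : \sum_(k <- T2) mdiff k w ^+ 2 = \sum_(k <- T) mdiff k w ^+ 2.
  by rewrite (perm_big _ pe).
rewrite /z mulrDr mulrDr lerD2r.
have zX : z0 <= X w.
  rewrite lerDl sumr_ge0// => a _.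
  by apply: le_trans (avg_sqr_le _ _ _); exact: sqr_ge0.
(* The leftover [z0^m] fits into the summand [z0] of [z], as [z0 <= X] and [1 <= m]. *)
apply: (@le_trans _ _ (X w `^ (m - 1) * z0)); last first.
  by rewrite ler_peMl// mulr_ge0// powR_ge0.
by rewrite -(@mulr_powRB1 _ z0 m)//; [rewrite mulrC ler_wpM2r// le_powR|lra].
Qed.

(** The Bellman argument bounds [E h^m] for [h = chain_proj^2 + z2]. By superadditivity of [t^m] a
    full [E z2^m] can be subtracted again, which is the [- 1] in [constant_comparison]; without it
    the constant would already be too large at [m = 1]. *)
Lemma martingale_le : expect T (fun w => (chain_proj w ^+ 2) `^ m) <=
  ((2 * m - 1) ^+ 4 * m) `^ m * expect T (fun w => z2 w `^ m).
Proof.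
have m1' := m1.
set K := m * (4 * m - 2).
have K2 : 2 <= K by rewrite /K; nra.
pose h w := chain_proj w ^+ 2 + z2 w.
have h0 w : 0 <= h w by rewrite addr_ge0// sqr_ge0.
have H : expect T (fun w => h w `^ m) <= K `^ m * expect T (fun w => z2 w `^ m).
  apply: expect_absorb => //; first by lra.
  have := @expect_bellman R (martingale_step m) lexL T T pdiff (fun=> x0) (fun=> z0).
  move=> /(_ (fun x z d => @martingale_step_le R m x z d m1) (fun _ => id) lexLT).
  move=> /(_ (fun _ _ _ => erefl) (fun _ _ _ => erefl) (fun=> z00) pdiff_flip).
  move=> /(_ (fun j i => @pdiff_inv j i)).
  rewrite expect_cst /martingale_step -/K expectB expectZ -/z0.
  rewrite -[(z0 + z0) `^ m]mulr_powRB1 ?addr_ge0//; last lra.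
  have := mulr_ge0 z00 (powR_ge0 (z0 + z0) (m - 1)) => P.
  under [X in _ - K * expect T X <= _ -> _]eq_fun do rewrite mulrC.
  rewrite -/h; nra.
have S : expect T (fun w => (chain_proj w ^+ 2) `^ m) + expect T (fun w => z2 w `^ m)
    <= expect T (fun w => h w `^ m).
  rewrite -expectD; apply: expect_le => w.
  rewrite -!(@mulr_powRB1 _ _ m) ?sqr_ge0//; [|lra..].
  rewrite [leRHS]mulrDl; apply: lerD; apply: ler_wpM2l => //; rewrite ?sqr_ge0//.
    by apply: le_powR; rewrite ?sqr_ge0// /h lerDl.
  by apply: le_powR; rewrite // /h lerDr sqr_ge0.
have := constant_comparison m1; rewrite -/K => CC.
have E0 : 0 <= expect T (fun w => z2 w `^ m) by apply: expect_ge0 => w; exact: powR_ge0.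
have := ler_wpM2r E0 CC; rewrite mulrBl mul1r; lra.
Qed.

Lemma chain_proj_le_ge2 : expect T (fun w => (chain_proj w ^+ 2) `^ m) <=
  (m ^+ 3 * (2 * m - 1) ^+ 4) `^ m * expect T (fun w => (f w ^+ 2) `^ m).
Proof.
have m1' := m1.
apply: (le_trans martingale_le).
rewrite (_ : m ^+ 3 * _ = ((2 * m - 1) ^+ 4 * m) * (m * m)); last by ring.
have A0 : 0 <= (2 * m - 1) ^+ 4 * m by rewrite mulr_ge0// exprn_ge0//; lra.
move: ((2 * m - 1) ^+ 4 * m) A0 => A A0.
rewrite powRM ?mulr_ge0// -mulrA ler_wpM2l ?powR_ge0//.
rewrite powRM// -mulrA; apply: (@le_trans _ _ (expect T (fun w => X w `^ m))).
  by apply: expect_le => w; exact: le_powR.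
apply: (le_trans stein_le); rewrite ler_wpM2l ?powR_ge0//.
exact: square_function_le.
Qed.

End Bound.
End ChainProjection.

(** * The bound for all exponents, by duality *)

Section ChainProjectionBound.
Context {R : realType}.
Implicit Types (p : R) (f g : Omega -> R).
Variables (J : set (seq nat)) (T : seq (seq nat)).
Hypothesis lexLT : pairwise lexL T.

Definition conj_exp p : R := p / (p - 1).
Definition proj_const p : R :=
  (Num.max p (conj_exp p) - 1) ^+ 2 * (Num.max p (conj_exp p) / 2) `^ (3 / 2).

Lemma conj_exp_gt1 p : 1 < p -> 1 < conj_exp p.
Proof. by move=> p1; rewrite /conj_exp ltr_pdivlMr; lra. Qed.

Lemma conj_expK p : 1 < p -> conj_exp (conj_exp p) = p.
Proof. by move=> p1; rewrite /conj_exp; field; lra. Qed.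

Lemma conj_exp_inv p : 1 < p -> p^-1 + (conj_exp p)^-1 = 1.
Proof. by move=> p1; rewrite /conj_exp; field; lra. Qed.

Lemma proj_const_conj p : 1 < p -> proj_const (conj_exp p) = proj_const p.
Proof. by move=> p1; rewrite /proj_const conj_expK// maxC. Qed.

Lemma proj_const_ge2 p : 2 <= p -> proj_const p = (p - 1) ^+ 2 * (p / 2) `^ (3 / 2).
Proof.
move=> p2; rewrite /proj_const max_l// /conj_exp ler_pdivrMr; last lra.
nra.
Qed.

Lemma proj_const_gt0 p : 1 < p -> 0 < proj_const p.
Proof.
move=> p1; have q1 := conj_exp_gt1 p1; rewrite /proj_const.
have [h|h] := leP p (conj_exp p); rewrite mulr_gt0// ?exprn_gt0 ?powR_gt0//; lra.
Qed.

Lemma chain_proj_depends f : depends_on [set` T] f -> depends_on [set` T] (chain_proj J T f).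
Proof.
move=> fT w w' ww'; rewrite /chain_proj; congr (_ + _); apply: eq_bigr => a _.
by apply: depends_on_avg ww'; exact: mdiff_depends.
Qed.

(** Self-adjointness in the form that duality uses: each [pdiff] of [g] is a function of the chain
    of prefixes of one coordinate, to which [chain_proj_orth] applies. *)
Lemma chain_proj_orth_proj f g : depends_on [set` T] f -> depends_on [set` T] g ->
  expect T (fun w => (f w - chain_proj J T f w) * chain_proj J T g w) = 0.
Proof.
move=> fT gT.
have -> : (fun w => (f w - chain_proj J T f w) * chain_proj J T g w) =
    (fun w => (f w - chain_proj J T f w) * expect T g +
      \sum_(a <- T) (f w - chain_proj J T f w) * pdiff J T g a w).
  by apply/funext => w; rewrite [in LHS]/(chain_proj J T g) mulrDr mulr_sumr.
rewrite expectD expect_sum (@chain_proj_orth _ J T f lexLT fT T [::])// add0r.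
rewrite big1// => a _.
apply: (@chain_proj_orth _ J T f lexLT fT T [seq b <- T | `[< J b >] && prefix b a]) => //.
- by move=> b; rewrite mem_filter => /andP[].
- by move=> b; rewrite mem_filter => /andP[/andP[/asboolP]].
- move=> b c; rewrite !mem_filter => /andP[/andP[_ ba] _] /andP[/andP[_ ca] _].
  exact: prefix_comparable ba ca.
- move=> w w' ww'; apply: (pdiff_depends gT) => b [bT /asboolP Jb ba].
  by apply: ww'; rewrite /= mem_filter Jb ba.
Qed.

Lemma sqr_powR_norm p (x : R) : (x ^+ 2) `^ (p / 2) = `|x| `^ p.
Proof.
rewrite -real_normK ?num_real// -powR_mulrn//.
by rewrite -powRrM; congr (_ `^ _); field.
Qed.

Lemma chain_proj_le_p_ge2 p f : 2 <= p -> depends_on [set` T] f ->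
  expect T (fun w => `|chain_proj J T f w| `^ p)
    <= proj_const p `^ p * expect T (fun w => `|f w| `^ p).
Proof.
move=> p2 fT; have m1 : 1 <= p / 2 by rewrite ler_pdivlMr// mul1r.
have := chain_proj_le_ge2 J lexLT fT m1.
under eq_fun do rewrite sqr_powR_norm.
under [X in _ <= _ * expect T X -> _]eq_fun do rewrite sqr_powR_norm.
suff -> : ((p / 2) ^+ 3 * (2 * (p / 2) - 1) ^+ 4) `^ (p / 2) = proj_const p `^ p by [].
rewrite -[in RHS](ger0_norm (ltW (proj_const_gt0 _))); last lra.
rewrite -sqr_powR_norm; congr (_ `^ _); rewrite proj_const_ge2// [in RHS]exprMn.
rewrite -[X in _ = _ * X]powR_mulrn ?powR_ge0// -powRrM.
rewrite (_ : 3 / 2 * 2%:R = 3%:R :> R); last by field.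
by rewrite powR_mulrn; [field|lra].
Qed.

(** For [p < 2] the function [phi = sg g |g|^(p-1)] norms [g], and its projection [psi] is bounded
    in [L_q] with [q >= 2]. The constant is symmetric in [p] and [q], so nothing is lost. *)
Lemma chain_proj_le p f : 1 < p -> depends_on [set` T] f ->
  expect T (fun w => `|chain_proj J T f w| `^ p)
    <= proj_const p `^ p * expect T (fun w => `|f w| `^ p).
Proof.
move=> p1 fT; have [|p2] := leP 2 p; first by move/chain_proj_le_p_ge2; exact.
pose q := conj_exp p; pose C := proj_const p.
have C0 : 0 < C by exact: proj_const_gt0.
have q0 : 0 < q by have := conj_exp_gt1 p1; rewrite -/q; lra.
have q2 : 2 <= q by rewrite /q /conj_exp ler_pdivlMr; lra.
have p0 : 0 < p by lra.
pose g := chain_proj J T f.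
pose phi w := Num.sg (g w) * `|g w| `^ (p - 1).
pose psi := chain_proj J T phi.
have phiT : depends_on [set` T] phi.
  by move=> w w' ww'; rewrite /phi /g (chain_proj_depends fT ww').
have phiq w : `|phi w| `^ q = `|g w| `^ p.
  have [g0|g0] := eqVneq (g w) 0.
    by rewrite /phi g0 sgr0 mul0r normr0 !powR0// gt_eqF.
  rewrite /phi normrM normr_sg g0 mul1r ger0_norm ?powR_ge0// -powRrM.
  by congr (_ `^ _); rewrite /q /conj_exp; field; lra.
have gphi w : `|g w| `^ p = g w * phi w.
  by rewrite /phi mulrA [g w * _]mulrC -normrEsg mulr_powRB1.
have H1 := chain_proj_orth_proj fT phiT; have H2 := chain_proj_orth_proj phiT fT.
(* [E g phi = E g psi = E f psi]: one orthogonality relation for each equality. *)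
have E1 : expect T (fun w => `|g w| `^ p) = expect T (fun w => f w * psi w).
  under eq_fun do rewrite gphi.
  apply: (@etrans _ _ (expect T (fun w => g w * psi w))).
    apply/eqP; rewrite -subr_eq0 -expectB -H2; apply/eqP; congr expect.
    by apply/funext => w; rewrite /psi /g; ring.
  apply/esym/eqP; rewrite -subr_eq0 -expectB -H1; apply/eqP; congr expect.
  by apply/funext => w; rewrite /psi /g; ring.
have E2 : expect T (fun w => `|psi w| `^ q) <= C `^ q * expect T (fun w => `|g w| `^ p).
  have := @chain_proj_le_p_ge2 q phi q2 phiT.
  rewrite /C -(proj_const_conj p1) -/q.
  by under [X in _ <= _ * expect T X -> _]eq_fun do rewrite phiq.
(* Young's inequality with weights [C] and [1/C], chosen so that the second term becomes at most
   [G / q], where [G = E |g|^p]; absorbing it leaves [G / p] on the left. *)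
have E3 : expect T (fun w => f w * psi w) <=
    (C `^ p * expect T (fun w => `|f w| `^ p)) / p
    + ((C `^ q)^-1 * expect T (fun w => `|psi w| `^ q)) / q.
  rewrite [X in _ <= X + _]mulrC [X in _ <= _ + X]mulrC -!expectZ -expectD.
  apply: expect_le => w.
  have := @conjugate_powR R (C * `|f w|) (`|psi w| / C) p q _ _ p0 q0 (conj_exp_inv p1).
  rewrite mulr_ge0 ?divr_ge0 ?(ltW C0)//= => /(_ isT isT).
  have -> : C * `|f w| * (`|psi w| / C) = `|f w * psi w|.
    by rewrite normrM; field; rewrite gt_eqF.
  move=> /(le_trans (ler_norm _)) /le_trans; apply.
  have CV0 : 0 <= C^-1 by rewrite invr_ge0 ltW.
  rewrite (@powRM _ C `|f w| p (ltW C0) (normr_ge0 _)).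
  rewrite (@powRM _ `|psi w| C^-1 q (normr_ge0 _) CV0).
  have -> : C^-1 `^ q = (C `^ q)^-1.
    by rewrite -(powR_inv1 (ltW C0)) powRAC powR_inv1// powR_ge0.
  rewrite le_eqVlt; apply/orP; left; apply/eqP.
  by congr (_ + _); rewrite [LHS]mulrC//; congr (_ * _); rewrite mulrC.
have Cq0 : 0 < C `^ q by exact: powR_gt0.
have E4 : (C `^ q)^-1 * expect T (fun w => `|psi w| `^ q) <= expect T (fun w => `|g w| `^ p).
  by rewrite ler_pdivrMl.
move: E1 E3 E4; rewrite -/g.
set G := expect T (fun w => `|g w| `^ p); set F := C `^ p * _; set P := _ * expect _ _.
move=> <- E3 E4.
have : G <= F / p + G / q.
  by apply: (le_trans E3); rewrite lerD2l ler_pM2r ?invr_gt0.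
have -> : G / q = G - G / p.
  have -> : q^-1 = 1 - p^-1 by have := conj_exp_inv p1; rewrite -/q; lra.
  by rewrite mulrBr mulr1.
move=> h; have : G / p <= F / p by lra.
by rewrite ler_pM2r ?invr_gt0.
Qed.

End ChainProjectionBound.

(** * Invariance of the coin measure *)

(** Fixes an initial segment of coordinates in the enumeration [CodeSeq]; these are the sets whose
    preimage in [[0, 1[] under [bits] is one dyadic interval. *)
Definition cell (b : seq bool) : set Omega :=
  [set w | forall n, (n < size b)%N -> w (CodeSeq.decode n) = nth false b n].

(** [b] as a binary numeral, most significant digit first: the position of that interval. *)
Definition cell_index (b : seq bool) : nat := foldl (fun j (c : bool) => 2 * j + c)%N 0%N b.

Lemma cell_nil : cell [::] = setT.
Proof. by apply/seteqP; split. Qed.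

Lemma cell_rcons b c w : cell (rcons b c) w <-> cell b w /\ w (CodeSeq.decode (size b)) = c.
Proof.
split=> [H|[H wc] n].
  split; last by rewrite H ?size_rcons ?ltnS// nth_rcons ltnn eqxx.
  by move=> n nb; rewrite H ?size_rcons ?(ltn_trans nb)// nth_rcons nb.
rewrite size_rcons ltnS leq_eqVlt => /orP[/eqP->|nb].
  by rewrite nth_rcons ltnn eqxx.
by rewrite nth_rcons nb; exact: H.
Qed.

Lemma cell_index_rcons b c : cell_index (rcons b c) = (2 * cell_index b + c)%N.
Proof. by rewrite /cell_index -cats1 foldl_cat. Qed.

Lemma cell_index_lt b : (cell_index b < 2 ^ size b)%N.
Proof.
elim/last_ind: b => // b c IH; rewrite cell_index_rcons size_rcons expnS.
by case: c; rewrite ?addn0 ?addn1; [rewrite -(leq_pmul2l (isT : 0 < 2)%N) mulnS in IH|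
  rewrite ltn_pmul2l].
Qed.

Lemma cell_disjoint_or_sub b c : (size b <= size c)%N ->
  cell b `&` cell c = cell c \/ cell b `&` cell c = set0.
Proof.
move=> bc; have [H|/existsNP[n /not_implyP[nb e]]] :=
    pselect (forall n, (n < size b)%N -> nth false c n = nth false b n).
  left; rewrite setIidr// => w wc n nb; rewrite -H// wc//.
  exact: leq_trans nb bc.
right; apply/seteqP; split => // w [wb wc]; apply: e.
by rewrite -wc ?wb//; exact: leq_trans nb bc.
Qed.

Lemma measurable_coord (a : seq nat) : measurable [set w : Omega | w a = true].
Proof. by apply: sub_sigma_algebra; exists a. Qed.

Lemma measurable_fun_omega d (X : measurableType d) (phi : X -> Omega) :
  (forall a, measurable [set x | phi x a = true]) -> measurable_fun setT phi.
Proof.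
move=> H; apply: (@measurability _ _ X Omega setT phi cyl) => //.
by move=> _ [_ [a _ <-] <-]; rewrite setTI; exact: H.
Qed.

Lemma measurable_cell b : measurable (cell b).
Proof.
elim/last_ind: b => [|b c IH]; first by rewrite cell_nil.
have -> : cell (rcons b c) = cell b `&` (if c
    then [set w : Omega | w (CodeSeq.decode (size b)) = true]
    else ~` [set w : Omega | w (CodeSeq.decode (size b)) = true]).
  apply/seteqP; split => w; rewrite /= cell_rcons.
    by case: c => -[? e]; split => //=; rewrite e.
  by case: c => -[? /= e]; split => //; apply/negbTE/negP.
apply: measurableI => //; case: c; last apply: measurableC; exact: measurable_coord.
Qed.

Definition cells : set (set Omega) := [set A | A = set0 \/ exists b, A = cell b].

Lemma cells_setI : setI_closed cells.
Proof.
move=> A B [->|[b ->]] [->|[c ->]]; rewrite ?set0I ?setI0; try by left.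
have [/cell_disjoint_or_sub[->|->]|/ltnW] := leqP (size b) (size c).
- by right; exists c.
- by left.
- rewrite setIC => /cell_disjoint_or_sub[->|->]; last by left.
  by right; exists b.
Qed.

Lemma cells_generate (A : set Omega) : measurable A -> <<s cells >> A.
Proof.
apply: smallest_sub; first exact: smallest_sigma_algebra.
move=> _ [a _ <-]; pose N := CodeSeq.code a.
have -> : [set w | w a = true] =
    \bigcup_(b : seq bool) (if (size b == N.+1) && nth false b N then cell b else set0).
  apply/seteqP; split => [w wa|w [b _]].
    exists (mkseq (fun n => w (CodeSeq.decode n)) N.+1) => //.
    rewrite size_mkseq eqxx/= nth_mkseq// CodeSeq.codeK wa => n.
    by rewrite size_mkseq => nN; rewrite nth_mkseq.
  case: ifP => // /andP[/eqP sb bN] H /=.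
  by rewrite -[a]CodeSeq.codeK H ?sb.
apply: (@countable_bigcupT_measurable _ (g_sigma_algebraType cells)) => //.
move=> b; case: ifP => _; last exact: measurable0.
by apply: sub_sigma_algebra; right; exists b.
Qed.

Section CoinMeasure.
Context {R : realType}.
Local Notation coin := (@coin R).

(** Digit by digit: once [y = x 2^n] lies in [[j, j + 1[], the next digit tells in which half, since
    an odd interval [[2 m + 1, 2 m + 2[] can contain [2 y] only for [m = j]. *)
Lemma bits_cell b (x : R) : 0 <= x < 1 -> cell b (bits R x) <->
  (cell_index b)%:R <= x * 2 ^+ size b < (cell_index b).+1%:R.
Proof.
move=> x01; elim/last_ind: b => [|b c IH].
  by rewrite cell_nil/= expr0 mulr1 /cell_index/=; split.
rewrite cell_rcons IH cell_index_rcons size_rcons exprS /bits CodeSeq.decodeK.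
set j := cell_index b; set y := x * 2 ^+ size b.
have -> : x * (2 * 2 ^+ size b) = 2 * y by rewrite /y; ring.
have digE : dig_set R (size b) x <-> exists m : nat, (2 * m + 1)%:R <= 2 * y < (2 * m + 2)%:R.
  rewrite /dig_set; split.
    move=> [m _ /=]; rewrite in_itv/= ler_pdivrMr ?exprn_gt0// ltr_pdivlMr ?exprn_gt0//.
    by rewrite exprS (_ : x * (2 * _) = 2 * y); [exists m|rewrite /y; ring].
  move=> [m H]; exists m => //=; rewrite in_itv/=.
  rewrite ler_pdivrMr ?exprn_gt0// ltr_pdivlMr ?exprn_gt0//.
  by rewrite exprS (_ : x * (2 * _) = 2 * y)//; rewrite /y; ring.
have digj : j%:R <= y < j.+1%:R -> dig_set R (size b) x <-> (2 * j + 1)%:R <= 2 * y.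
  rewrite -natr1 => /andP[jy yj]; rewrite digE; split => [[m /andP[my ym]]|jy1]; last first.
    by exists j; rewrite jy1/= natrD natrM; lra.
  suff -> : j = m by [].
  apply/eqP; rewrite eqn_leq; apply/andP; split; rewrite -ltnS -(@ltr_nat R) -natr1.
    by move: ym; rewrite natrD natrM; lra.
  by move: my; rewrite natrD natrM; lra.
split=> [[jy e]|].
  have := digj jy; rewrite -natr1 in jy; move/andP: jy => [jy yj].
  case: c e => /asboolP e H; rewrite /= -natr1 ?natrD ?natrM; apply/andP.
    by move/H: e; rewrite natrD natrM => e; split; lra.
  split; first lra.
  rewrite ltNge; apply/negP => h; apply: e; apply/H; rewrite natrD natrM; lra.
move=> cy; have jy : j%:R <= y < j.+1%:R.
  by move: cy; rewrite -!natr1 natrD natrM; case: c => /= /andP[h1 h2]; apply/andP; split; lra.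
split => //; have H := digj jy; case: c cy => /= /andP[h1 h2].
  by apply/asboolP/H.
apply/asboolP => /H; rewrite natrD natrM.
by move: h2; rewrite addn0 -[(2 * j).+1%:R]natr1 natrM; lra.
Qed.

Lemma coin_cell b : coin (cell b) = (2 ^- size b)%:E.
Proof.
rewrite /coin /pushforward /lam01 /mrestr.
have p0 : 0 < 2 ^+ size b :> R by rewrite exprn_gt0.
have -> : bits R @^-1` cell b `&` `[0, 1[%classic =
    `[(cell_index b)%:R / 2 ^+ size b, (cell_index b).+1%:R / 2 ^+ size b[%classic :> set R.
  apply/seteqP; split => x /=; rewrite in_itv/=.
    rewrite in_itv/= => -[+ x01]; rewrite bits_cell//.
    by rewrite ler_pdivrMr// ltr_pdivlMr.
  rewrite in_itv/= => /andP[h1 h2].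
  have x01 : 0 <= x < 1.
    apply/andP; split; first by apply: le_trans h1; rewrite divr_ge0// ltW.
    apply: (lt_le_trans h2); rewrite ler_pdivrMr// mul1r -natrX ler_nat.
    exact: cell_index_lt.
  split => //; apply/bits_cell => //.
  by rewrite -ler_pdivrMr// -ltr_pdivlMr// h1.
rewrite lebesgue_measure_itv/= lte_fin ltr_pM2r ?invr_gt0// ltr_nat ltnSn.
rewrite -EFinB; congr EFin; rewrite -mulrBl -natr1; field.
by rewrite gt_eqF.
Qed.

Lemma coin_setT : coin setT = 1%E.
Proof. by rewrite -cell_nil coin_cell/= expr0 invr1. Qed.

Definition preserving (phi : Omega -> Omega) := measurable_fun setT phi /\
  forall A, measurable A -> coin (phi @^-1` A) = coin A.

(** Uniqueness of finite measures agreeing on a generating pi-system, for [coin] and its image under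
    [phi]. *)
Lemma preserving_generated (G : set (set Omega)) phi : measurable_fun setT phi ->
  G `<=` measurable -> G setT -> setI_closed G ->
  (forall A, measurable A -> <<s G >> A) ->
  (forall A, G A -> coin (phi @^-1` A) = coin A) -> preserving phi.
Proof.
move=> mphi Gm GT GI Gs H; split => // A mA.
have cov : \bigcup_(k : nat) [set: Omega] = setT.
  by apply: bigcup_const; exists 0%N.
have U := @g_sigma_algebra_measure_unique _ R Omega G Gm (fun=> setT) (fun=> GT) cov.
apply/esym; apply: (U coin (pushforward coin phi)) => //.
- by move=> B GB; exact/esym/H.
- by move=> k; change (coin setT < +oo)%E; rewrite coin_setT ltry.
- exact: Gs.
Qed.

Lemma measurable_flip a : measurable_fun setT (flip a).
Proof.
apply: measurable_fun_omega => b; rewrite /flip.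
have [->|_] := eqVneq b a; last exact: measurable_coord.
rewrite (_ : mkset _ = ~` [set w : Omega | w a = true]).
  by apply: measurableC; exact: measurable_coord.
by apply/seteqP; split => w /=; [move=> /negP|move=> /negP].
Qed.

(** The preimage of a cell is a cell of the same length, hence of the same measure. *)
Lemma preserving_flip a : preserving (flip a).
Proof.
apply: (@preserving_generated cells).
- exact: measurable_flip.
- by move=> _ [->|[b ->]]; [exact: measurable0|exact: measurable_cell].
- by right; exists [::]; rewrite cell_nil.
- exact: cells_setI.
- exact: cells_generate.
move=> _ [->|[b ->]]; first by rewrite preimage_set0.
pose N := CodeSeq.code a.
pose b' := mkseq (fun n => if n == N then ~~ nth false b n else nth false b n) (size b).
suff -> : flip a @^-1` cell b = cell b' by rewrite !coin_cell size_mkseq.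
apply/seteqP; split => w /= H n.
  rewrite size_mkseq => nb; rewrite nth_mkseq// -H// /flip.
  by rewrite /N (can2_eq CodeSeq.decodeK CodeSeq.codeK); case: eqP; rewrite ?negbK.
move=> nb; have := H n; rewrite size_mkseq nth_mkseq// => /(_ nb).
rewrite /flip (can2_eq CodeSeq.decodeK CodeSeq.codeK) -/N => ->.
by case: eqP; rewrite ?negbK.
Qed.

End CoinMeasure.

(** * Lebesgue norms and cylinder functions *)

Section LpToolkit.
Context {R : realType}.
Local Notation coin := (@coin R).
Implicit Types (f g h : Omega -> R) (s r : R) (T : seq (seq nat)).

Lemma coin_measureT : (coin : {measure set Omega -> \bar R}) [set: Omega] = 1%E.
Proof. exact: coin_setT. Qed.

Lemma LnpE s f : Lnp s f = ((\int[coin]_w (`|f w| `^ s)%:E) `^ s^-1)%E.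
Proof. by rewrite /Lnp unlock; congr (_ `^ _)%E; apply: eq_integral. Qed.

Lemma Lnp_pow s f : s != 0 -> ((Lnp s f) `^ s)%E = (\int[coin]_w (`|f w| `^ s)%:E)%E.
Proof. by move=> s0; rewrite /Lnp powR_Lnorm//; apply: eq_integral. Qed.

Lemma Lnp_ge0 s f : (0 <= Lnp s f)%E.
Proof. exact: Lnorm_ge0. Qed.

Lemma inLp_fin s f : inLp s f -> Lnp s f \is a fin_num.
Proof. by move=> [_ h]; rewrite ge0_fin_numE ?Lnp_ge0. Qed.

Lemma measurable_pow_norm s f : measurable_fun setT f ->
  measurable_fun setT ((fun w => (`|f w| `^ s)%:E) : Omega -> \bar R).
Proof.
move=> mf; apply/measurable_EFinP.
apply: (@measurableT_comp _ _ _ _ _ _ (@powR R ^~ s) setT (fun w => `|f w|)) => //.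
exact: measurableT_comp.
Qed.

Lemma preserving_integral phi (f : Omega -> \bar R) : @preserving R phi ->
  measurable_fun setT f -> (\int[coin]_w f (phi w) = \int[coin]_w f w)%E.
Proof.
move=> [mphi H] mf.
have ge0 (g : Omega -> \bar R) : measurable_fun setT g -> (forall w, 0 <= g w)%E ->
    (\int[coin]_w (g \o phi) w = \int[coin]_w g w)%E.
  move=> mg g0; have := @ge0_integral_pushforward _ _ Omega Omega R phi mphi coin setT g.
  rewrite preimage_setT => <-//.
  by apply: eq_measure_integral => A mA _; exact: H.
rewrite [LHS]integralE [RHS]integralE -/(f \o phi) funepos_comp funeneg_comp.
by rewrite !ge0//; [exact: measurable_funeneg|exact: measurable_funepos].
Qed.

Lemma Lnp_comp phi s f : @preserving R phi -> measurable_fun setT f ->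
  Lnp s (f \o phi) = Lnp s f.
Proof.
move=> pphi mf; rewrite !LnpE -(preserving_integral pphi (measurable_pow_norm s mf)).
by [].
Qed.

Lemma Lnp_triangle s f g h : 1 <= s -> measurable_fun setT f -> measurable_fun setT g ->
  measurable_fun setT h -> (Lnp s (fsub f h) <= Lnp s (fsub f g) + Lnp s (fsub g h))%E.
Proof.
move=> s1 mf mg mh; rewrite /Lnp.
have -> : EFin \o fsub f h = EFin \o (fsub f g \+ fsub g h).
  by apply/funext => w /=; rewrite /fsub addrA subrK.
by apply: minkowski_EFin => //; exact: measurable_funB.
Qed.

Lemma LnpD s f g : 1 <= s -> measurable_fun setT f -> measurable_fun setT g ->
  (Lnp s (fun w => f w + g w)%R <= Lnp s f + Lnp s g)%E.
Proof. by move=> s1 mf mg; exact: minkowski_EFin. Qed.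

Lemma LnpZ s c f : 0 < s -> measurable_fun setT f ->
  Lnp s (fun w => c * f w) = (`|c|%:E * Lnp s f)%E.
Proof.
move=> s0 mf; rewrite !LnpE.
under eq_integral do rewrite normrM powRM// EFinM.
rewrite ge0_integralZl ?lee_fin ?powR_ge0//; last exact: measurable_pow_norm.
rewrite poweRM ?lee_fin ?powR_ge0//; last first.
  by apply: integral_ge0 => w _; rewrite lee_fin powR_ge0.
by rewrite poweR_EFin -powRrM mulfV ?gt_eqF// powRr1.
Qed.

Lemma Lnp_le s f g : 0 < s -> measurable_fun setT f -> measurable_fun setT g ->
  (forall w, `|f w| <= `|g w|) -> (Lnp s f <= Lnp s g)%E.
Proof.
move=> s0 mf mg fg; rewrite !LnpE.
apply: gt0_ler_poweR; rewrite ?invr_ge0 ?(ltW s0) ?in_itv/= ?leey ?andbT//.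
- by apply: integral_ge0 => w _; rewrite lee_fin powR_ge0.
- by apply: integral_ge0 => w _; rewrite lee_fin powR_ge0.
apply: ge0_le_integral => //.
- exact: measurable_pow_norm.
- exact: measurable_pow_norm.
by move=> w _; rewrite lee_fin; apply: le_powR; rewrite ?(ltW s0).
Qed.

(** A null [L_2] distance is how [orth_proj] expresses equality almost everywhere; it therefore
    transfers to every exponent. *)
Lemma Lnp_ae_eq s f g : 0 < s -> measurable_fun setT f -> measurable_fun setT g ->
  Lnp 2 (fsub f g) = 0%E -> Lnp s f = Lnp s g.
Proof.
move=> s0 mf mg e; rewrite !LnpE; congr (_ `^ _)%E.
apply: ge0_ae_eq_integral => //; [exact: measurable_pow_norm..|].
have mfg : measurable_fun setT (EFin \o fsub f g).
  by apply/measurable_EFinP; exact: measurable_funB.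
apply: filterS (Lnorm_eq0_eq0 mfg _ e); last by rewrite lte_fin.
by move=> w /(_ Logic.I) /= [] /eqP; rewrite subr_eq0 => /eqP -> _.
Qed.

Lemma Lnp_subC s f g : Lnp s (fsub f g) = Lnp s (fsub g f).
Proof. by rewrite !LnpE /fsub; under eq_integral do rewrite distrC. Qed.

Lemma Lnp_cst s c : 0 < s -> Lnp s (fun=> c) = `|c|%:E.
Proof.
move=> s0; rewrite LnpE integral_cst// coin_measureT mule1 poweR_EFin -powRrM.
by rewrite mulfV ?gt_eqF// powRr1.
Qed.

(** Hölder's inequality against the constant 1, whose norms are 1 because [coin] is a
    probability. *)
Lemma Lnp_le_exp s r f : 0 < s -> s <= r -> measurable_fun setT f ->
  (Lnp s f <= Lnp r f)%E.
Proof.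
move=> s0; rewrite le_eqVlt => /predU1P[->//|sr] mf.
have r0 : 0 < r by exact: lt_trans sr.
have a1 : 1 < r / s by rewrite ltr_pdivlMr// mul1r.
have q1 := conj_exp_gt1 a1.
pose g w := `|f w| `^ s.
have mg : measurable_fun setT g.
  by apply/measurable_EFinP; exact: measurable_pow_norm.
have := @hoelder _ Omega R coin g (fun=> 1) (r / s) (conj_exp (r / s)) mg.
move=> /(_ (measurable_cst _)).
have -> : 0 < r / s by exact: lt_trans a1.
have -> : 0 < conj_exp (r / s) by exact: lt_trans q1.
move=> /(_ isT isT (conj_exp_inv a1)).
rewrite -![Lnorm _ _ _]/(Lnp _ _) Lnp_cst; last exact: lt_trans q1.
rewrite normr1 mule1 => H.
rewrite (LnpE s).
have -> : Lnp r f = ((Lnp (r / s) g) `^ s^-1)%E.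
  rewrite !LnpE -poweRrM; congr (_ `^ _)%E.
    apply: eq_integral => w _; congr EFin.
    rewrite /g [in RHS]ger0_norm ?powR_ge0// -powRrM.
    by congr (_ `^ _); field; rewrite gt_eqF.
  by field; rewrite !gt_eqF.
apply: gt0_ler_poweR; rewrite ?invr_ge0 ?(ltW s0)//.
- rewrite in_itv/= leey andbT; apply: integral_ge0 => w _.
  by rewrite lee_fin powR_ge0.
- by rewrite in_itv/= leey andbT Lnp_ge0.
apply: le_trans H; rewrite /Lnp Lnorm1 le_eqVlt; apply/orP; left; apply/eqP.
by apply: eq_integral => w _ /=; congr EFin; rewrite mulr1 [RHS]ger0_norm ?powR_ge0.
Qed.

Lemma inLpD s f g : 1 <= s -> inLp s f -> inLp s g -> inLp s (fun w => f w + g w).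
Proof.
move=> s1 [mf hf] [mg hg]; split; first exact: measurable_funD.
by apply: (le_lt_trans (LnpD s1 mf mg)); rewrite lte_add_pinfty.
Qed.

Lemma inLpZ s c f : 1 <= s -> inLp s f -> inLp s (fun w => c * f w).
Proof.
move=> s1 [mf hf]; split; first exact: measurable_funM.
by rewrite LnpZ//; [rewrite lte_mul_pinfty// lee_fin|exact: lt_le_trans s1].
Qed.

Lemma inLpB s f g : 1 <= s -> inLp s f -> inLp s g -> inLp s (fsub f g).
Proof.
move=> s1 hf hg; have := inLpD s1 hf (inLpZ (-1) s1 hg).
by congr inLp; apply/funext => w; rewrite mulN1r.
Qed.

Definition setcoord (a : seq nat) (c : bool) (w : Omega) : Omega :=
  fun b => if b == a then c else w b.

(** A function of finitely many coordinates is a finite decision tree that tests one bit per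
    node. *)
Lemma cylinder_ind (P : (Omega -> R) -> Prop) :
  (forall c, P (fun=> c)) ->
  (forall a f g, P f -> P g -> P (fun w => if w a then f w else g w)) ->
  forall T f, depends_on [set` T] f -> P f.
Proof.
move=> P0 Pif; elim=> [|a T IH] f fT.
  have -> : f = fun=> f (fun=> false) by apply/funext => w; apply: fT.
  exact: P0.
have -> : f = fun w => if w a then f (setcoord a true w) else f (setcoord a false w).
  apply/funext => w; have wE c : w a = c -> w = setcoord a c w.
    by move=> wa; apply/funext => b; rewrite /setcoord; case: eqP => // ->.
  by case wa: (w a); rewrite -wE.
apply: Pif; apply: IH => w w' ww'; apply: fT => b; rewrite /setcoord /= inE;
  by case: eqP => //= _ /ww'.
Qed.

Lemma measurable_bit a : measurable_fun setT (fun w : Omega => w a).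
Proof.
apply: (@measurable_fun_bool _ _ _ _ true); rewrite setTI.
exact: measurable_coord.
Qed.

Lemma measurable_cylinder T f : depends_on [set` T] f -> measurable_fun setT f.
Proof.
move: T f; apply: cylinder_ind; first by move=> c; exact: measurable_cst.
by move=> a f g mf mg; apply: measurable_fun_ifT => //; exact: measurable_bit.
Qed.

Lemma bounded_cylinder T f : depends_on [set` T] f -> exists M, forall w, `|f w| <= M.
Proof.
move: T f; apply: cylinder_ind; first by move=> c; exists `|c|.
move=> a f g [M fM] [N gN]; exists (Num.max M N) => w.
by case: ifP => _; rewrite le_max ?fM// gN orbT.
Qed.

Lemma integrable_bounded f : measurable_fun setT f -> (exists M, forall w, `|f w| <= M) ->
  (coin).-integrable setT (EFin \o f).
Proof.
move=> mf [M fM]; apply: measurable_bounded_integrable => //.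
  by change (coin setT < +oo)%E; rewrite coin_setT ltry.
exists M; split; first exact: num_real.
by move=> x Mx w _; exact: le_trans (fM w) (ltW Mx).
Qed.

Lemma integral_avg T f : measurable_fun setT f -> (exists M, forall w, `|f w| <= M) ->
  [/\ measurable_fun setT (avg T f), exists M, forall w, `|avg T f w| <= M &
     (\int[coin]_w (avg T f w)%:E = \int[coin]_w (f w)%:E)%E].
Proof.
move=> mf bf; elim: T => [|a T [mg bg e]] //.
rewrite [avg _ _]/=; move: (avg T f) mg bg e => g mg [M gM] <-.
have mgf : measurable_fun setT (g \o flip a).
  by apply: measurableT_comp => //; exact: measurable_flip.
split.
- by apply: measurable_funM => //; exact: measurable_funD.
- exists M => w; rewrite /avg1 normrM [`|2^-1|]ger0_norm// ler_pdivrMr//.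
  by apply: (le_trans (ler_normD _ _)); have := gM w; have := gM (flip a w); lra.
have ig : (coin).-integrable setT (EFin \o g) by apply: integrable_bounded => //; exists M.
have ih : (coin).-integrable setT (EFin \o (g \o flip a)).
  by apply: integrable_bounded => //; exists M => w /=; exact: gM.
rewrite /avg1; under eq_integral do rewrite mulrC EFinM EFinD.
rewrite integralZl//; last exact: integrableD.
rewrite (integralD_EFin _ ig ih)//.
rewrite (@preserving_integral (flip a) (EFin \o g) (preserving_flip _)); last first.
  exact/measurable_EFinP.
rewrite -mule2n -[(_ *+ 2)%E]mule_natl muleA -EFinM mulVf// mul1e//.
Qed.

(** Flips preserve [coin], so averaging keeps the integral, and averaging over all of [T] leaves a
    constant. *)
Lemma integral_cylinder T f : depends_on [set` T] f ->
  (\int[coin]_w (f w)%:E = (expect T f)%:E)%E.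
Proof.
move=> fT; have [_ _ <-] :=
  integral_avg T (measurable_cylinder fT) (bounded_cylinder fT).
have D : depends_on set0 (avg T f).
  apply: (@depends_on_sub _ T); first exact: depends_on_avg.
  by move=> a aT _; exact: avg_inv.
have -> : avg T f = fun=> expect T f by apply/funext => w; exact: D.
by rewrite integral_cst// coin_measureT mule1.
Qed.

Lemma Lnp_cylinder s T f : depends_on [set` T] f ->
  Lnp s f = ((expect T (fun w => `|f w| `^ s)) `^ s^-1)%:E.
Proof.
move=> fT; rewrite LnpE (@integral_cylinder T) ?poweR_EFin//.
by move=> w w' ww'; rewrite (fT w w').
Qed.

Lemma inLp_cylinder s T f : depends_on [set` T] f -> inLp s f.
Proof.
move=> fT; split; first exact: measurable_cylinder fT.
by rewrite (Lnp_cylinder s fT) ltry.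
Qed.

(** A second generating pi-system: shifts scatter an initial segment of coordinates, so they do not
    preserve cells, but they map these sets to sets of the same kind. *)
Definition all_true (A : seq (seq nat)) : set Omega := [set w | {in A, forall a, w a = true}].

Lemma measurable_all_true A : measurable (all_true A).
Proof.
elim: A => [|a A IH]; first by rewrite (_ : all_true _ = setT)//; apply/seteqP; split.
have -> : all_true (a :: A) = [set w : Omega | w a = true] `&` all_true A.
  apply/seteqP; split => w /=.
    by move=> H; split=> [|b bA]; apply: H; rewrite inE ?eqxx// bA orbT.
  by move=> [wa wA] b; rewrite inE => /orP[/eqP->//|/wA].
by apply: measurableI => //; exact: measurable_coord.
Qed.

(** Flipping [a] exchanges the two halves of [all_true A], so each further condition halves the
    measure. *)
Lemma coin_all_true A : uniq A -> coin (all_true A) = (2 ^- size A)%:E.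
Proof.
elim: A => [|a A IH] /= => [_|/andP[aA uA]].
  rewrite expr0 invr1 -(@coin_setT R); congr coin; by apply/seteqP; split.
have [_ F] := @preserving_flip R a.
have -> : coin (all_true (a :: A)) = (2^-1%:E * coin (all_true A))%E; last first.
  by rewrite IH// -EFinM exprS invfM.
have AE : all_true A = all_true (a :: A) `|` (flip a @^-1` all_true (a :: A)).
  apply/seteqP; split => w /=.
    move=> H; case wa: (w a); [left|right] => b; rewrite inE => /orP[/eqP->//|bA].
    - exact: H.
    - by rewrite /flip eqxx wa.
    - rewrite /flip; case: eqP => [ba|_]; last exact: H.
      by rewrite -ba bA in aA.
  move=> [H|H] b bA; first by apply: H; rewrite inE bA orbT.
  have := H b; rewrite inE bA orbT => /(_ isT); rewrite /flip; case: eqP => // ba.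
  by rewrite -ba bA in aA.
have mA := measurable_all_true (a :: A).
have mF : measurable (flip a @^-1` all_true (a :: A)).
  by rewrite -[X in measurable X]setTI; apply: measurable_flip.
rewrite [in RHS]AE.
have -> : coin (all_true (a :: A) `|` flip a @^-1` all_true (a :: A)) =
    (coin (all_true (a :: A)) + coin (flip a @^-1` all_true (a :: A)))%E.
  apply: (measureU coin) => //; apply/seteqP; split => // w /= [h1 h2].
  have := h2 a; rewrite /flip inE eqxx (h1 a) ?mem_head// => /(_ isT) //.
rewrite F// -mule2n -[(_ *+ 2)%E]mule_natl muleA -EFinM mulVf// mul1e//.
Qed.

Lemma measurable_shiftw n : measurable_fun setT (shiftw n).
Proof. by apply: measurable_fun_omega => a; exact: measurable_coord. Qed.

Lemma preserving_shiftw n : @preserving R (shiftw n).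
Proof.
apply: (@preserving_generated _ [set all_true A | A in [set: seq (seq nat)]]).
- exact: measurable_shiftw.
- by move=> _ [A _ <-]; exact: measurable_all_true.
- by exists [::] => //; apply/seteqP; split.
- move=> _ _ [A _ <-] [B _ <-]; exists (A ++ B) => //; apply/seteqP; split => w /=.
    by move=> H; split => a aA; apply: H; rewrite mem_cat aA ?orbT.
  by move=> [hA hB] a; rewrite mem_cat => /orP[/hA|/hB].
- apply: smallest_sub; first exact: smallest_sigma_algebra.
  move=> _ [a _ <-]; apply: sub_sigma_algebra; exists [:: a] => //.
  apply/seteqP; split => w /=; first by apply; rewrite mem_head.
  by move=> wa b; rewrite inE => /eqP->.
move=> _ [A _ <-].
have uE B : all_true (undup B) = all_true B.
  by apply/seteqP; split => w H a; move=> aB; apply: H; move: aB; rewrite mem_undup.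
have -> : shiftw n @^-1` all_true A = all_true [seq n :: a | a <- undup A].
  apply/seteqP; split => w /= H a.
    by move=> /mapP[b bA ->]; apply: H; rewrite -mem_undup.
  by move=> aA; rewrite /shiftw; apply: H; rewrite map_f// mem_undup.
rewrite -(uE A) !coin_all_true ?undup_uniq ?size_map//.
by rewrite map_inj_uniq ?undup_uniq// => a b [].
Qed.

End LpToolkit.

(** * Density of cylinder functions *)

Section Density.
Context {R : realType}.
Local Notation coin := (@coin R).
Implicit Types (f g h : Omega -> R) (s r : R) (T : seq (seq nat)).

Lemma Lnp_dominated r f (h : nat -> Omega -> R) (F : Omega -> R) : 1 <= r ->
  measurable_fun setT f -> (forall n, measurable_fun setT (h n)) -> inLp r F ->
  (forall n w, `|h n w| <= F w) -> (forall w, h n w @[n --> \oo] --> f w) ->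
  forall e : R, 0 < e -> exists n, (Lnp r (fsub f (h n)) < e%:E)%E.
Proof.
move=> r1 mf mh LF hF hf e e0; have r0 : 0 < r by exact: lt_le_trans r1.
have rn0 : r != 0 by rewrite gt_eqF.
have [mF2 LF2] := inLpZ 2 r1 LF.
have fF w : `|f w| <= F w.
  have c : `|h n w| @[n --> \oo] --> `|f w| by apply: cvg_norm; exact: hf.
  rewrite -(cvg_lim _ c)//; apply: limr_le; first by apply/cvg_ex; exists `|f w|.
  by apply: nearW => n; exact: hF.
pose u n w : \bar R := (`|fsub f (h n) w| `^ r)%:E.
have mu_ n : measurable_fun setT (u n) by apply: measurable_pow_norm; exact: measurable_funB.
pose G w : \bar R := (`|2 * F w| `^ r)%:E.
have iG : (coin).-integrable setT G.
  apply/integrableP; split; first exact: measurable_pow_norm.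
  under eq_integral do rewrite /G gee0_abs ?lee_fin ?powR_ge0//.
  by rewrite -Lnp_pow// poweR_lty.
have H1 : {ae coin, forall w, setT w -> u n w @[n --> \oo] --> cst 0%E w}.
  apply: aeW => w _; rewrite /u.
  have -> : cst 0%E w = (0 `^ r)%:E :> \bar R by rewrite powR0.
  apply: cvg_EFin; first by apply: nearW.
  have c0 : `|fsub f (h n) w| @[n --> \oo] --> (0 : R).
    rewrite -[X in _ --> X](@normr0 _ R) -(subrr (f w)); apply: cvg_norm.
    by apply: cvgB; [exact: cvg_cst|exact: hf].
  apply/cvgrPdist_lt => d d0.
  have dr : 0 < d `^ r^-1 by exact: powR_gt0.
  move/cvgrPdist_lt : c0 => /(_ _ dr); apply: filterS => n.
  rewrite !sub0r !normrN normr_id powR0// sub0r normrN => hn.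
  rewrite ger0_norm ?powR_ge0//.
  have := @gt0_ltr_powR R r r0 `|fsub f (h n) w| (d `^ r^-1).
  by rewrite !nnegrE normr_ge0 powR_ge0 -powRrM mulVf// powRr1 ?(ltW d0)//; apply.
have H2 : {ae coin, forall w, forall n, setT w -> (`|u n w| <= G w)%E}.
  apply: aeW => w n _; rewrite /u /G gee0_abs ?lee_fin ?powR_ge0//.
  apply: le_powR; rewrite ?(ltW r0)//.
  rewrite normrM ger0_norm// (ger0_norm (le_trans (normr_ge0 _) (fF w))).
  rewrite /fsub; apply: (le_trans (ler_normB _ _)).
  by have := fF w; have := hF n w; lra.
have [_ _] := @dominated_convergence _ Omega R coin setT measurableT u (cst 0%E) G
  mu_ (measurable_cst _) H1 iG H2.
rewrite integral0 => C.
have er : 0 < e `^ r by exact: powR_gt0.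
have /fine_cvgP[+ /cvgrPdist_lt /(_ _ er)] := C.
move=> [N1 _ f1] [N2 _ f2]; exists (maxn N1 N2).
have := f1 (maxn N1 N2) (leq_maxl _ _); have := f2 (maxn N1 N2) (leq_maxr _ _).
rewrite /= sub0r normrN /u -Lnp_pow//; set L := Lnp r _.
have L0 : (0 <= L)%E by exact: Lnp_ge0.
case: L L0 => [x|//|//]; last by rewrite poweRyr.
rewrite lee_fin => x0; rewrite poweR_EFin/= ger0_norm ?powR_ge0// => xe _.
rewrite lte_fin ltNge; apply/negP => ex; move: xe; rewrite ltNge => /negP; apply.
by apply: le_powR; rewrite ?(ltW r0) ?(ltW e0).
Qed.

(** Freezes the coordinates outside [I]. Composition with it makes any function depend on [I] only
    and does not change one that already does; it is used pointwise, not to transport the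
    measure. *)
Definition restrict (I : set (seq nat)) (w : Omega) : Omega := fun a => `[< I a >] && w a.

Lemma restrict_depends (I : set (seq nat)) f w : depends_on I f -> f (restrict I w) = f w.
Proof. by move=> If; apply: If => a Ia; rewrite /restrict asboolT. Qed.

Lemma measurable_restrict I : measurable_fun setT (restrict I).
Proof.
apply: measurable_fun_omega => a; rewrite /restrict.
have [Ia|Ia] := asboolP (I a); first exact: measurable_coord.
by rewrite (_ : mkset _ = set0)//; apply/seteqP; split.
Qed.

Definition cylinder (I : set (seq nat)) f :=
  exists2 T : seq (seq nat), (forall a, a \in T -> I a) & depends_on [set` T] f.

Lemma cylinder2 I f g : cylinder I f -> cylinder I g -> exists T : seq (seq nat),
  [/\ forall a, a \in T -> I a, depends_on [set` T] f & depends_on [set` T] g].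
Proof.
move=> [T TI fT] [S SI gS]; exists (T ++ S); split.
- by move=> a; rewrite mem_cat => /orP[/TI|/SI].
- by move=> w w' ww'; apply: fT => a aT; apply: ww'; rewrite /= mem_cat aT.
- by move=> w w' ww'; apply: gS => a aT; apply: ww'; rewrite /= mem_cat aT orbT.
Qed.

Lemma cylinder_lin I c f g : cylinder I f -> cylinder I g ->
  cylinder I (fun w => c * f w + g w).
Proof.
move=> cf cg; have [T [TI fT gT]] := cylinder2 cf cg; exists T => // w w' ww'.
by rewrite (fT w w') ?(gT w w').
Qed.

Lemma cylinder_measurable I f : cylinder I f -> measurable_fun setT f.
Proof. by move=> [T _ /measurable_cylinder]. Qed.

Lemma cylinder_Lsub s I f : cylinder I f -> Lsub s I f.
Proof.
move=> [T TI fT]; split; first exact: inLp_cylinder fT.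
by move=> w w' ww'; apply: fT => a /TI; exact: ww'.
Qed.

Section Closure.
Variables (r : R) (S : set (Omega -> R)).
Hypothesis r1 : 1 <= r.
Hypothesis Sm : forall f, S f -> measurable_fun setT f.
Hypothesis S_lin : forall c f g, S f -> S g -> S (fun w => c * f w + g w).
Let r0 : 0 < r. Proof. exact: lt_le_trans r1. Qed.

(** [pclosure] with measurability as the only ambient condition, so that closures for different
    exponents can be compared without carrying a coordinate set. *)
Definition Lclosure f := measurable_fun setT f /\
  forall e : R, 0 < e -> exists2 g, S g & (Lnp r (fsub f g) < e%:E)%E.

Lemma Lclosure_incl f : S f -> Lclosure f.
Proof.
move=> cf; split; first exact: Sm.
move=> e e0; exists f => //; rewrite (_ : fsub f f = fun=> 0).
  by rewrite Lnp_cst// normr0 lte_fin.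
by apply/funext => w; rewrite /fsub subrr.
Qed.

Lemma Lclosure_closed f : measurable_fun setT f ->
  (forall e : R, 0 < e -> exists2 h, Lclosure h & (Lnp r (fsub f h) < e%:E)%E) ->
  Lclosure f.
Proof.
move=> mf H; split => // e e0.
have e20 : 0 < e / 2 by rewrite divr_gt0.
have [h [mh /(_ _ e20)[g cg hg]] fh] := H _ e20.
exists g => //; have mg := Sm cg.
apply: (le_lt_trans (Lnp_triangle r1 mf mh mg)).
by rewrite [in X in (_ < X)%E](splitr e) EFinD lteD.
Qed.

Lemma Lclosure_lin c f g : Lclosure f -> Lclosure g ->
  Lclosure (fun w => c * f w + g w).
Proof.
move=> [mf af] [mg ag]; split.
  by apply: measurable_funD => //; exact: measurable_funM.
move=> e e0; pose d := e / 2 / (`|c| + 1).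
have c1 : 0 < `|c| + 1 by rewrite ltr_wpDl.
have d0 : 0 < d by rewrite !divr_gt0.
have e20 : 0 < e / 2 by rewrite divr_gt0.
have [f' cf' ff'] := af _ d0; have [g' cg' gg'] := ag _ e20.
exists (fun w => c * f' w + g' w); first exact: S_lin.
have mf' := Sm cf'; have mg' := Sm cg'.
have mff : measurable_fun setT (fsub f f') by exact: measurable_funB.
have mgg : measurable_fun setT (fsub g g') by exact: measurable_funB.
rewrite (_ : fsub _ _ = (fun w => c * fsub f f' w + fsub g g' w)); last first.
  by apply/funext => w; rewrite /fsub; ring.
apply: (le_lt_trans (LnpD r1 _ mgg)); first exact: measurable_funM.
rewrite LnpZ// (splitr e) EFinD; apply: lte_leD => //; last exact: ltW.
  by rewrite ge0_fin_numE ?Lnp_ge0// (lt_trans gg')// ltry.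
apply: (@le_lt_trans _ _ (`|c|%:E * d%:E)%E).
  by apply: lee_wpmul2l => //; exact: ltW.
rewrite -EFinM lte_fin /d mulrCA -[ltRHS]mulr1 ltr_pM2l// ltr_pdivrMr// mul1r.
by rewrite ltrDl.
Qed.

End Closure.

Section Approx.
Variables (r : R) (I : set (seq nat)).
Hypothesis r1 : 1 <= r.
Let r0 : 0 < r. Proof. exact: lt_le_trans r1. Qed.

Definition approx f := Lclosure r (cylinder I) f.

Let approx_cylinder f : cylinder I f -> approx f.
Proof. by apply: Lclosure_incl => //; exact: cylinder_measurable. Qed.

Let approx_closed f : measurable_fun setT f ->
  (forall e : R, 0 < e -> exists2 h, approx h & (Lnp r (fsub f h) < e%:E)%E) -> approx f.
Proof. by apply: Lclosure_closed => //; exact: cylinder_measurable. Qed.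

Let approx_lin c f g : approx f -> approx g -> approx (fun w => c * f w + g w).
Proof.
apply: Lclosure_lin => //; first exact: cylinder_measurable.
by move=> *; exact: cylinder_lin.
Qed.

Lemma approx_sum (K : Type) (t : seq K) (F : K -> Omega -> R) :
  (forall k, approx (F k)) -> approx (fun w => \sum_(k <- t) F k w).
Proof.
move=> H; elim: t => [|k t IH].
  under eq_fun do rewrite big_nil.
  by apply: approx_cylinder; exists [::].
have := approx_lin 1 (H k) IH; congr approx.
by apply/funext => w; rewrite big_cons mul1r.
Qed.

(** Dynkin's theorem for the pi-system [all_true]: complements by linearity, disjoint unions by
    dominated convergence of the partial sums of indicators. *)
Lemma approx_indic (A : set Omega) : measurable A ->
  approx (fun w => \1_A (restrict I w)).
Proof.
have mind B : measurable B -> measurable_fun setT (fun w => \1_B (restrict I w) : R).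
  move=> mB; have mI : measurable_fun setT (\1_B : Omega -> R) by exact: measurable_indic.
  exact: (measurableT_comp mI (measurable_restrict I)).
pose G := [set all_true B | B in [set: seq (seq nat)]].
have GE : measurable = <<s G >> :> set (set Omega).
  apply/seteqP; split.
    apply: smallest_sub; first exact: smallest_sigma_algebra.
    move=> _ [a _ <-]; apply: sub_sigma_algebra; exists [:: a] => //.
    apply/seteqP; split => w /=; first by apply; rewrite mem_head.
    by move=> wa b; rewrite inE => /eqP->.
  apply: smallest_sub; first exact: sigma_algebra_measurable.
  by move=> _ [B _ <-]; exact: measurable_all_true.
move=> mA; have {mA} : <<s G >> A by rewrite -GE.
apply: (@dynkin_induction _ Omega G (fun A => approx (fun w => \1_A (restrict I w))) GE).
- move=> _ _ [B _ <-] [C _ <-]; exists (B ++ C) => //; apply/seteqP; split => w /=.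
    by move=> H; split => a aA; apply: H; rewrite mem_cat aA ?orbT.
  by move=> [hA hB] a; rewrite mem_cat => /orP[/hA|/hB].
- by apply: approx_cylinder; exists [::] => // w w' _; rewrite !indicT.
- move=> _ [B _ <-]; apply: approx_cylinder; exists [seq a <- B | `[< I a >]].
    by move=> a; rewrite mem_filter => /andP[/asboolP].
  move=> w w' ww'; rewrite !indicE; congr (_%:R); congr nat_of_bool.
  have rE a : a \in B -> restrict I w a = restrict I w' a.
    move=> aB; rewrite /restrict; case: asboolP => // Ia /=.
    by apply: ww'; rewrite /= mem_filter asboolT.
  by apply/idP/idP; rewrite !inE => H a aB; have := H a aB; rewrite rE.
- move=> B mB aB; have := approx_lin (-1) aB (_ : approx (fun=> 1)).
  have -> : (fun w => \1_(~` B) (restrict I w)) =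
      (fun w => -1 * \1_B (restrict I w) + 1) :> (Omega -> R).
    by apply/funext => w; rewrite !indicE in_setC; case: (_ \in B) => /=; ring.
  by apply; apply: approx_cylinder; exists [::].
- move=> F mF tF aF; apply: approx_closed.
    by apply: mind; exact: bigcupT_measurable.
  move=> e e0.
  pose h n w : R := \1_(\big[setU/set0]_(i < n) F i) (restrict I w).
  have hE n : h n = fun w => \sum_(i < n) \1_(F i) (restrict I w).
    apply/funext => w; rewrite /h; elim: n => [|n IH].
      by rewrite !big_ord0 indicE in_set0.
    rewrite !big_ord_recr/= -IH !indicE in_setU.
    have [wn|_] := boolP (_ \in F n); last by rewrite orbF addr0.
    have [wi|_] := boolP (_ \in \big[_/_]_(i < n) F i); last by rewrite add0r.
    exfalso; move: wi; rewrite inE -bigcup_mkord => -[i /= iN Fi].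
    move/trivIsetP: tF => /(_ i n Logic.I Logic.I); rewrite (ltn_eqF iN) => /(_ isT).
    move=> E; have : (F i `&` F n) (restrict I w) by split => //; exact: set_mem.
    by rewrite E.
  have mU n : measurable (\big[setU/set0]_(i < n) F i) by exact: bigsetU_measurable.
  have L1 : inLp r (fun=> 1 : R) by apply: (@inLp_cylinder _ _ [::]).
  have [||||n hn] := @Lnp_dominated r (fun w => \1_(\bigcup_k F k) (restrict I w)) h
      (fun=> 1) r1 _ _ L1 _ _ e e0.
  - by apply: mind; exact: bigcupT_measurable.
  - by move=> n; exact: mind.
  - by move=> n w; rewrite /h indicE; case: (_ \in _); rewrite ?normr1 ?normr0.
  - move=> w; have [[k _ Fk]|nF] := pselect ((\bigcup_k F k) (restrict I w)).
      apply: cvg_near_cst; exists k.+1 => // n /= kn.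
      rewrite /h !indicE; congr (_%:R); congr nat_of_bool.
      rewrite !mem_set//; first by exists k.
      by rewrite -bigcup_mkord; exists k.
    apply: cvg_near_cst; apply: nearW => n; rewrite /h !indicE; congr (_%:R).
    congr nat_of_bool; rewrite !memNset// -bigcup_mkord => -[k _ Fk].
    by apply: nF; exists k.
  exists (h n) => //; rewrite hE.
  by have := @approx_sum _ (index_enum 'I_n) (fun i w => \1_(F i) (restrict I w)) (fun i => aF i).
Qed.

Import HBNNSimple.

(** Simple functions increasing to [f], dominated by [f] itself; freezing their arguments makes each
    of them a combination of the indicators of [approx_indic]. *)
Lemma approx_ge0 f : (forall w, 0 <= f w) -> Lsub r I f -> approx f.
Proof.
move=> f0 [Lf If]; have [mf _] := Lf; apply: approx_closed => // e e0.
have mEf : measurable_fun setT (EFin \o f) by exact/measurable_EFinP.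
pose h := nnsfun_approx measurableT mEf.
have ch w : h n w @[n --> \oo] --> f w.
  have /fine_cvgP[_] := @cvg_nnsfun_approx _ _ _ _ measurableT _ mEf
    (fun x _ => f0 x : (0 <= (f x)%:E)%E) w Logic.I.
  exact.
have hle n w : h n w <= f w.
  rewrite -(cvg_lim _ (ch w))//; apply: nondecreasing_cvgn_le.
    move=> i j ij; have := @nd_nnsfun_approx _ _ _ _ measurableT _ mEf i j ij.
    by move=> /lefP.
  by apply/cvg_ex; exists (f w).
have [|||n hn] := @Lnp_dominated r f (fun n => h n \o restrict I) f r1 mf _ Lf _ _ e e0.
- by move=> n; apply: measurableT_comp => //; exact: measurable_restrict.
- by move=> n w /=; rewrite ger0_norm// -(restrict_depends w If).
- by move=> w; rewrite -(restrict_depends w If); exact: ch.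
exists (h n \o restrict I) => //.
have -> : h n \o restrict I =
   fun w => \sum_(y <- finmap.enum_fset (fset_set (range (h n))))
      (y * \1_(h n @^-1` [set y]) (restrict I w)).
  apply/funext => w /=; rewrite fimfunE fsbig_finite//.
apply: approx_sum => y.
have my : measurable (h n @^-1` [set y]).
  by rewrite -[X in measurable X]setTI; apply: measurable_funP => //; exact: measurable_set1.
have c0 : cylinder I (fun=> 0 : R) by exists [::].
have := approx_lin y (approx_indic my) (approx_cylinder c0).
by congr approx; apply/funext => w; rewrite addr0.
Qed.

Lemma approx_Lsub f : Lsub r I f -> approx f.
Proof.
move=> [[mf Lf] If].
have part (g : Omega -> R) : measurable_fun setT g -> (forall w, 0 <= g w <= `|f w|) ->
    depends_on I g -> approx g.
  move=> mg gf Ig; apply: approx_ge0; first by move=> w; have /andP[] := gf w.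
  split => //; split => //; apply: le_lt_trans Lf.
  apply: Lnp_le => // w.
  by have /andP[g0 gw] := gf w; rewrite (ger0_norm g0).
have ap : approx (fun w => Num.max (f w) 0).
  apply: part.
  - exact: measurable_maxr.
  - by move=> w; rewrite le_max lexx orbT ge_max ler_norm normr_ge0.
  - by move=> w w' /If ->.
have am : approx (fun w => Num.max (- f w) 0).
  apply: part.
  - by apply: measurable_maxr => //; exact: measurableT_comp.
  - by move=> w; rewrite le_max lexx orbT ge_max -normrN ler_norm normr_ge0.
  - by move=> w w' /If ->.
have := approx_lin (-1) am ap; congr approx; apply/funext => w.
by rewrite mulN1r; case: (leP (f w) 0) => h; case: (leP (- f w) 0) => h'; lra.
Qed.

End Approx.
End Density.

(** * Limits and inner products *)

Section Limits.
Context {R : realType}.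
Local Notation coin := (@coin R).
Implicit Types (f g h : Omega -> R) (s r : R).

Lemma cvg_powR (u : nat -> R) (l s : R) : 0 < s -> (forall n, 0 <= u n) ->
  u n @[n --> \oo] --> l -> u n `^ s @[n --> \oo] --> l `^ s.
Proof.
move=> s0 u0 ul; have l0 : 0 <= l.
  rewrite -(cvg_lim _ ul)//; apply: limr_ge; first by apply/cvg_ex; exists l.
  exact: nearW.
move: l0; rewrite le_eqVlt => /predU1P[l0|l0]; last first.
  have cp : {for l, continuous (@powR R ^~ s)}.
    apply: differentiable_continuous; apply/derivable1_diffP.
    by apply: derivable_powR; rewrite in_itv/= l0.
  exact: (cvg_comp _ _ ul cp).
rewrite -l0 powR0 ?gt_eqF//; apply/cvgrPdist_lt => d d0.
have dr : 0 < d `^ s^-1 by exact: powR_gt0.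
move/cvgrPdist_lt : ul => /(_ _ dr); apply: filterS => n.
rewrite -l0 !sub0r !normrN !ger0_norm ?powR_ge0// => un.
have := @gt0_ltr_powR R s s0 (u n) (d `^ s^-1).
by rewrite !nnegrE u0 powR_ge0 -powRrM mulVf ?gt_eqF// powRr1 ?(ltW d0)//; apply.
Qed.

Lemma Lnp_fatou s h (hn : nat -> Omega -> R) (B : \bar R) : 0 < s ->
  measurable_fun setT h -> (forall n, measurable_fun setT (hn n)) ->
  {ae coin, forall w, hn n w @[n --> \oo] --> h w} ->
  (forall n, (Lnp s (hn n) <= B)%E) -> (Lnp s h <= B)%E.
Proof.
move=> s0 mh mhn cv HB.
have B0 : (0 <= B)%E by apply: le_trans (HB 0%N); exact: Lnp_ge0.
have sn0 : s != 0 by rewrite gt_eqF.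
pose u n w : \bar R := (`|hn n w| `^ s)%:E.
have mu_ n : measurable_fun setT (u n) by exact: measurable_pow_norm.
have u0 n w : (0 <= u n w)%E by rewrite lee_fin powR_ge0.
have ae_lim : {ae coin, forall w, limn_einf (u^~ w) = (`|h w| `^ s)%:E}.
  apply: filterS cv => w cw.
  have c1 : u n w @[n --> \oo] --> (`|h w| `^ s)%:E.
    apply: cvg_EFin; first exact: nearW.
    by apply: cvg_powR => //; exact: cvg_norm.
  by rewrite is_cvg_limn_einfE ?(cvg_lim _ c1)//; apply/cvg_ex; exists (`|h w| `^ s)%:E.
have mlim : measurable_fun setT (fun w => limn_einf (u^~ w)).
  have -> : (fun w => limn_einf (u^~ w)) =
      (fun w => - limn_esup (fun n => - u n w))%E.
    apply/funext => w; rewrite -limn_einfN; congr limn_einf.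
    by apply/funext => n; rewrite /comp oppeK.
  apply: (measurableT_comp (oppe_measurable (D := setT))).
  apply: measurable_fun_limn_esup => n.
  by apply: (measurableT_comp (oppe_measurable (D := setT))).
have le_int : (\int[coin]_w (`|h w| `^ s)%:E <= B `^ s)%E.
  apply: (@le_trans _ _ (\int[coin]_w limn_einf (u^~ w))%E).
    apply: ae_ge0_le_integral => //.
    - exact: measurable_pow_norm.
    - move=> w _; rewrite limn_einf_lim; apply: lime_ge; first exact: is_cvg_einfs.
      by apply: nearW => n; apply: le_ereal_inf_tmp => _ [m /= nm <-].
    - by apply: filterS ae_lim => w -> _.
  apply: (le_trans (@fatou _ Omega R coin setT measurableT u mu_ (fun n w _ => u0 n w))).
  rewrite limn_einf_lim; apply: lime_le; first exact: is_cvg_einfs.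
  apply: nearW => n; apply: (@le_trans _ _ (\int[coin]_w u n w)%E).
    by apply: ereal_inf_lbound; exists n => /=.
  rewrite /u -Lnp_pow//; apply: gt0_ler_poweR; rewrite ?(ltW s0) ?in_itv/= ?leey ?andbT//.
  exact: Lnp_ge0.
rewrite LnpE; apply: (@le_trans _ _ ((B `^ s) `^ s^-1)%E).
  apply: gt0_ler_poweR; rewrite ?invr_ge0 ?(ltW s0) ?in_itv/= ?leey ?andbT//.
    by apply: integral_ge0 => w _; rewrite lee_fin powR_ge0.
  exact: poweR_ge0.
by rewrite -poweRrM mulfV// poweRe1.
Qed.

(** Geometric increments are summable in [L_1], so the telescoping series converges absolutely
    almost everywhere. The limit is taken as an upper limit at every point, which keeps it
    measurable and makes it depend only on the coordinates that the sequence depends on. *)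
Lemma ae_limit (g : nat -> Omega -> R) (c : R) : (forall k, measurable_fun setT (g k)) ->
  (forall k, (Lnp 2 (fsub (g k.+1) (g k)) <= (c * 2^-1 ^+ k)%:E)%E) ->
  exists2 h : Omega -> R, measurable_fun setT h &
    {ae coin, forall w, g n w @[n --> \oo] --> h w} /\
    (forall w w', (forall k, g k w = g k w') -> h w = h w').
Proof.
move=> mg H; exists (fun w => fine (limn_esup (fun k => (g k w)%:E))).
  apply: (measurableT_comp (@fine_measurable R setT measurableT)).
  by apply: measurable_fun_limn_esup => k; exact/measurable_EFinP.
split; last by move=> w w' e; under eq_fun do rewrite e.
pose u k w : \bar R := `|fsub (g k.+1) (g k) w|%:E.
have mu_ k : measurable_fun setT (u k).
  by apply/measurable_EFinP; apply: measurableT_comp => //; exact: measurable_funB.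
have iu k : (\int[coin]_w u k w <= (c * 2^-1 ^+ k)%:E)%E.
  apply: le_trans (H k); apply: le_trans (Lnp_le_exp _ _ _); rewrite ?ler1n//; last first.
    exact: measurable_funB.
  rewrite LnpE invr1 poweRe1; last by apply: integral_ge0 => w _; rewrite lee_fin powR_ge0.
  by under [X in (_ <= X)%E]eq_integral do rewrite powRr1//.
have c0 : 0 <= c.
  by have := le_trans (Lnp_ge0 _ _) (H 0%N); rewrite expr0 mulr1 lee_fin.
have iS : (coin).-integrable setT (fun w => \sum_(0 <= k <oo) u k w)%E.
  apply/integrableP; split.
    by apply: (@ge0_emeasurable_sum _ _ _ setT u xpredT) => // k w _ _; rewrite lee_fin.
  under eq_integral.
    move=> w _; rewrite gee0_abs; last by apply: nneseries_ge0 => k _ _; rewrite lee_fin.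
    over.
  rewrite integral_nneseries//; last by move=> k w _; rewrite lee_fin.
  apply: (@le_lt_trans _ _ (c * 2)%:E); last by rewrite ltry.
  apply: lime_le; first by apply: is_cvg_nneseries => k _ _; apply: integral_ge0 => w _; rewrite lee_fin.
  apply: nearW => n; apply: (@le_trans _ _ (\sum_(0 <= k < n) (c * 2^-1 ^+ k)%:E)%E).
    by apply: lee_sum => k _; exact: iu.
  rewrite sumEFin lee_fin -mulr_sumr ler_wpM2l// big_mkord.
  have := subrX1 (2^-1 : R) n; have : 0 <= (2^-1 : R) ^+ n by rewrite exprn_ge0.
  lra.
have := integrable_ae measurableT iS; apply: filterS => w /(_ Logic.I) fS.
have cs : cvgn (series (fun k => fsub (g k.+1) (g k) w)).
  apply: normed_cvg; apply: (@nondecreasing_is_cvgn).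
    by apply: nondecreasing_series => k _ _; exact: normr_ge0.
  exists (fine (\sum_(0 <= k <oo) u k w)%E) => _ [n _ <-].
  rewrite -lee_fin fineK// /series/= -sumEFin.
  by apply: nneseries_lim_ge => k _; rewrite lee_fin.
have gE n : g n w = g 0%N w + series (fun k => fsub (g k.+1) (g k) w) n.
  by rewrite /series/= /fsub telescope_sumr// addrC subrK.
have cg : cvgn (fun n => g n w).
  have -> : (fun n => g n w) = (fun n => g 0%N w + series (fun k => fsub (g k.+1) (g k) w) n).
    by apply/funext.
  by apply: is_cvgD => //; exact: is_cvg_cst.
have ce : (g n w)%:E @[n --> \oo] --> (limn (fun n => g n w))%:E.
  by apply: cvg_EFin => //; exact: nearW.
rewrite is_cvg_limn_esupE; last by apply/cvg_ex; exists (limn (fun n => g n w))%:E.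
by rewrite (cvg_lim _ ce).
Qed.

Lemma inLp2_Lfun f : inLp 2 f -> f \in Lfun coin 2%:E.
Proof. by move=> [mf Lf]; rewrite inE; apply/andP; split; rewrite inE. Qed.

Lemma ip_integrable f g : inLp 2 f -> inLp 2 g ->
  (coin).-integrable setT (fun w => (f w * g w)%:E).
Proof.
move=> /inLp2_Lfun Lf /inLp2_Lfun Lg.
by have := Lfun2_mul_Lfun1 Lf Lg => /Lfun1_integrable.
Qed.

Lemma ipC f g : ip f g = ip g f.
Proof. by rewrite /ip; under eq_integral do rewrite mulrC. Qed.

Lemma ip_fin f g : inLp 2 f -> inLp 2 g -> ip f g \is a fin_num.
Proof. by move=> Lf Lg; apply: integrable_fin_num => //; exact: ip_integrable. Qed.

Lemma ip_lin (c : R) f g h : inLp 2 f -> inLp 2 g -> inLp 2 h ->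
  ip (fun w => c * f w + g w) h = (c%:E * ip f h + ip g h)%E.
Proof.
move=> Lf Lg Lh; rewrite /ip.
have ifh := ip_integrable Lf Lh; have igh := ip_integrable Lg Lh.
rewrite -integralZl// -integralD//; last exact: integrableZl.
by apply: eq_integral => w _; rewrite -EFinM -EFinD; congr EFin; ring.
Qed.

Lemma ip_sub f g h : inLp 2 f -> inLp 2 g -> inLp 2 h ->
  ip (fsub f g) h = (ip f h - ip g h)%E.
Proof.
move=> Lf Lg Lh; have -> : fsub f g = (fun w => -1 * g w + f w).
  by apply/funext => w; rewrite /fsub; ring.
by rewrite ip_lin// EFinN mulN1e addeC.
Qed.

Lemma ip_abs_le f g : inLp 2 f -> inLp 2 g -> (`|ip f g| <= Lnp 2 f * Lnp 2 g)%E.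
Proof.
move=> Lf Lg; have [mf _] := Lf; have [mg _] := Lg.
have := @hoelder _ Omega R coin f g 2 2 mf mg.
rewrite ltr0n => /(_ isT isT) H; apply: le_trans (H _); last by field.
rewrite Lnorm1; apply: le_abse_integral => //.
by have /integrableP[] := ip_integrable Lf Lg.
Qed.

Lemma ip_self f : inLp 2 f -> ip f f = 0%E -> Lnp 2 f = 0%E.
Proof.
move=> Lf e; rewrite LnpE.
have -> : (\int[coin]_w (`|f w| `^ 2)%:E = ip f f)%E.
  by apply: eq_integral => w _; rewrite powR_mulrn// real_normK ?num_real// expr2.
by rewrite e poweR0r// invr_neq0.
Qed.

Lemma ip_cylinder T f g : depends_on [set` T] f -> depends_on [set` T] g ->
  ip f g = (expect T (fun w => f w * g w))%:E.
Proof.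
move=> fT gT; rewrite /ip (@integral_cylinder _ T)// => w w' ww'.
by rewrite (fT w w') ?(gT w w').
Qed.

End Limits.

(** * The orthogonal projection *)

Local Notation lspan := Defs.span.

Section Span.
Context {R : realType}.
Implicit Types (f g : Omega -> R) (S : set (Omega -> R)).

Lemma span_incl S f : S f -> lspan S f.
Proof.
move=> Sf; exists 1%N, (fun=> 1), (fun=> f); split => //.
by apply/funext => w; rewrite big_ord1 mul1r.
Qed.

Lemma span0 S : lspan S (fun=> 0).
Proof.
by exists 0%N, (fun=> 0), (fun _ _ => 0); split => [[]//|]; apply/funext => w; rewrite big_ord0.
Qed.

Lemma span_lin S c f g : lspan S f -> lspan S g -> lspan S (fun w => c * f w + g w).
Proof.
move=> [n [a [F [SF ->]]]] [m [b [G [SG ->]]]].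
exists (n + m)%N,
  (fun i => match fintype.split i with inl j => c * a j | inr j => b j end),
  (fun i => match fintype.split i with inl j => F j | inr j => G j end); split.
  by move=> i; case: (fintype.split i).
apply/funext => w; rewrite big_split_ord/= mulr_sumr; congr (_ + _); apply: eq_bigr => i _.
  by rewrite (unsplitK (inl _ i)) mulrA.
by rewrite (unsplitK (inr _ i)).
Qed.

Lemma span_ind S (P : (Omega -> R) -> Prop) : P (fun=> 0) ->
  (forall c f g, S f -> P g -> P (fun w => c * f w + g w)) -> forall f, lspan S f -> P f.
Proof.
move=> P0 Plin _ [n [c [F [SF ->]]]]; elim: n c F SF => [|n IH] c F SF.
  by rewrite (_ : (fun w => _) = fun=> 0)//; apply/funext => w; rewrite big_ord0.
have -> : (fun w => \sum_(i < n.+1) c i * F i w) =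
    (fun w => c ord0 * F ord0 w + \sum_(i < n) c (lift ord0 i) * F (lift ord0 i) w).
  by apply/funext => w; rewrite big_ord_recl.
by apply: Plin => //; exact: IH.
Qed.

(** Used for shifts and insertions of coordinates; the weight [chi] is an indicator of the root bit
    for the disjoint sum and 1 elsewhere. *)
Lemma span_weight S S' (chi : Omega -> R) (phi : Omega -> Omega) :
  (forall u, S u -> lspan S' (fun w => chi w * u (phi w))) ->
  forall f, lspan S f -> lspan S' (fun w => chi w * f (phi w)).
Proof.
move=> H; apply: span_ind => [|c f g Sf IH].
  by under eq_fun do rewrite mulr0; exact: span0.
have := span_lin c (H _ Sf) IH; congr (lspan S').
by apply/funext => w; ring.
Qed.

End Span.

Section ChainSpace.
Context {R : realType}.
Local Notation coin := (@coin R).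
Implicit Types (f g h u v : Omega -> R) (s : R).

Definition is_chain (J : set (seq nat)) u := exists C : seq (seq nat),
  [/\ forall a, a \in C -> J a,
      forall a b, a \in C -> b \in C -> prefix a b || prefix b a &
      depends_on [set` C] u].

Definition chain_space J := lspan (is_chain J).

Lemma chain_space_cst J c : chain_space J (fun=> c).
Proof. by apply: span_incl; exists [::]; split. Qed.

Lemma chain_space_cylinder J f : chain_space J f -> cylinder J f.
Proof.
move: f; apply: span_ind; first by exists [::].
move=> c f g [C [CJ _ fC]] cg; apply: cylinder_lin => //.
by exists C.
Qed.

Lemma chain_space_measurable J f : chain_space J f -> measurable_fun setT f.
Proof. by move=> /chain_space_cylinder /cylinder_measurable. Qed.

Lemma chain_space_inLp s J f : chain_space J f -> inLp s f.
Proof. by move=> /chain_space_cylinder /(cylinder_Lsub s) []. Qed.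

Lemma chain_space_orth J h : inLp 2 h -> (forall u, is_chain J u -> ip h u = 0%E) ->
  forall v, chain_space J v -> ip h v = 0%E.
Proof.
move=> Lh H v Vv.
suff [] : inLp 2 v /\ ip h v = 0%E by [].
move: v Vv; apply: span_ind.
  split; first exact: (@inLp_cylinder _ _ [::]).
  by rewrite /ip; under eq_integral do rewrite mulr0; rewrite integral0.
move=> c u v cu [Lv hv]; have Lu : inLp 2 u by case: cu => C [_ _ /inLp_cylinder].
split; first by apply: inLpD; rewrite ?ler1n//; apply: inLpZ; rewrite ?ler1n.
by rewrite ipC ip_lin// ![ip _ h]ipC H// hv mule0 adde0.
Qed.

(** One [g] serves every exponent, and the constant does not see how many coordinates [f] uses. *)
Lemma cylinder_proj J I f : cylinder I f -> exists g,
  [/\ chain_space J g, forall v, chain_space J v -> ip (fsub f g) v = 0%E &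
     forall p, 1 < p -> (Lnp p g <= (proj_const p)%:E * Lnp p f)%E].
Proof.
move=> [T0 _ fT0]; have [T lT TE] := lexL_sort T0.
have fT : depends_on [set` T] f.
  by move=> w w' ww'; apply: fT0 => a aT; apply: ww'; rewrite /= TE.
have gT := @chain_proj_depends _ J T f fT.
have fgT : depends_on [set` T] (fsub f (chain_proj J T f)).
  by move=> w w' ww'; rewrite /fsub (fT w w')// (gT w w').
exists (chain_proj J T f); split.
- rewrite /chain_proj; have S (t : seq (seq nat)) :
      chain_space J (fun w => \sum_(a <- t) pdiff J T f a w).
    elim: t => [|a t IH]; first by under eq_fun do rewrite big_nil; exact: span0.
    have : is_chain J (pdiff J T f a).
      exists [seq b <- T | `[< J b >] && prefix b a]; split.
      + by move=> b; rewrite mem_filter => /andP[/andP[/asboolP]].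
      + move=> b c; rewrite !mem_filter => /andP[/andP[_ ba] _] /andP[/andP[_ ca] _].
        exact: prefix_comparable ba ca.
      + move=> w w' ww'; apply: (pdiff_depends fT) => b [bT /asboolP Jb ba].
        by apply: ww'; rewrite /= mem_filter Jb ba.
    move=> /(@span_incl R) /(span_lin 1) /(_ IH); congr (lspan _).
    by apply/funext => w; rewrite big_cons mul1r.
  have := span_lin 1 (chain_space_cst J (expect T f)) (S T); congr (lspan _).
  by apply/funext => w; rewrite mul1r.
- apply: chain_space_orth; first exact: inLp_cylinder fgT.
  move=> u [C [CJ Cch uC]].
  rewrite (@ip_cylinder _ (T ++ C)).
  + by rewrite /fsub (@chain_proj_orth _ J T f lT fT (T ++ C) C)// => a aT;
      rewrite mem_cat aT ?orbT.
  + by move=> w w' ww'; apply: fgT => a aT; apply: ww'; rewrite /= mem_cat aT.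
  + by move=> w w' ww'; apply: uC => a aT; apply: ww'; rewrite /= mem_cat aT orbT.
- move=> p p1; have p0 : 0 < p by exact: lt_trans p1.
  rewrite (Lnp_cylinder p fT) (Lnp_cylinder p gT) -EFinM lee_fin.
  have E0 : 0 <= expect T (fun w => `|f w| `^ p) by apply: expect_ge0 => w; exact: powR_ge0.
  have G0 : 0 <= expect T (fun w => `|chain_proj J T f w| `^ p).
    by apply: expect_ge0 => w; exact: powR_ge0.
  have C0 : 0 <= proj_const p by exact/ltW/proj_const_gt0.
  have iv : 0 <= p^-1 by rewrite invr_ge0 ltW.
  apply: (le_trans (le_powR iv G0 (chain_proj_le J lT p1 fT))).
  by rewrite powRM ?powR_ge0// -powRrM mulfV ?gt_eqF// powRr1.
Qed.

Section Projection.
Variables (I J : set (seq nat)).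
Hypothesis JI : J `<=` I.
Local Notation V := (chain_space J).

Let two1 : 1 <= 2 :> R. Proof. by rewrite ler1n. Qed.

Let Vlin c f g : V f -> V g -> V (fun w => c * f w + g w).
Proof. exact: span_lin. Qed.

Lemma orth_closure h k : inLp 2 h -> inLp 2 k -> (forall v, V v -> ip h v = 0%E) ->
  Lclosure 2 V k -> ip h k = 0%E.
Proof.
move=> Lh Lk hV [_ kV].
have kfin := ip_fin Lh Lk; have hfin := inLp_fin Lh.
suff : forall e : R, 0 < e -> (`|ip h k| <= e%:E)%E.
  move=> H; apply/eqP; rewrite -abse_eq0 eq_le abse_ge0 andbT.
  by apply/lee_addgt0Pr => e e0; rewrite add0e; exact: H.
move=> e e0; pose N := fine (Lnp 2 h).
have N0 : 0 <= N by rewrite fine_ge0// Lnp_ge0.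
have d0 : 0 < e / (N + 1) by rewrite divr_gt0// ltr_wpDl.
have [v Vv kv] := kV _ d0.
have Lv := chain_space_inLp 2 Vv.
have -> : ip h k = ip h (fsub k v).
  by rewrite [RHS]ipC ip_sub// ![ip _ h]ipC (hV v Vv) sube0.
apply: (le_trans (ip_abs_le Lh (inLpB two1 Lk Lv))).
apply: (@le_trans _ _ (N%:E * (e / (N + 1))%:E)%E).
  by rewrite fineK//; apply: lee_wpmul2l; [exact: Lnp_ge0|exact: ltW].
rewrite -EFinM lee_fin mulrCA -[leRHS]mulr1 ler_pM2l// ler_pdivrMr ?ltr_wpDl//.
by rewrite mul1r lerDl.
Qed.

Lemma orth_closure0 h : inLp 2 h -> (forall v, V v -> ip h v = 0%E) ->
  Lclosure 2 V h -> Lnp 2 h = 0%E.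
Proof. by move=> Lh hV cV; apply: ip_self => //; exact: orth_closure. Qed.

(** Orthogonality determines [g] almost everywhere, so it inherits the bound of [cylinder_proj]. Not
    fixing [g] allows an application to differences of approximants, which yields the Cauchy
    estimates below. *)
Lemma proj_bound p f g : 1 < p -> cylinder I f -> V g ->
  (forall v, V v -> ip (fsub f g) v = 0%E) ->
  (Lnp p g <= (proj_const p)%:E * Lnp p f)%E.
Proof.
move=> p1 cf Vg fg; have [g' [Vg' fg' /(_ p p1)]] := cylinder_proj J cf.
have mg := chain_space_measurable Vg; have mg' := chain_space_measurable Vg'.
have [[Lf _] Lg Lg'] : [/\ Lsub 2 I f, inLp 2 g & inLp 2 g'].
  by split; [exact: cylinder_Lsub|exact: chain_space_inLp Vg|exact: chain_space_inLp Vg'].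
suff -> : Lnp p g = Lnp p g' by [].
apply: Lnp_ae_eq => //; first exact: lt_trans p1.
have Vgg : V (fsub g g').
  by have := Vlin (-1) Vg' Vg; congr (lspan _); apply/funext => w; rewrite /fsub; ring.
apply: orth_closure0; first exact: inLpB.
  move=> v Vv; have Lv := chain_space_inLp 2 Vv.
  have := fg v Vv; have := fg' v Vv; rewrite !ip_sub//.
  move: (ip_fin Lf Lv) (ip_fin Lg Lv) (ip_fin Lg' Lv).
  case: (ip f v) => // a _; case: (ip g v) => // b _; case: (ip g' v) => // c _.
  rewrite -!EFinB => -[ac] -[ab]; congr EFin; lra.
by apply: Lclosure_incl => // k /chain_space_measurable.
Qed.

End Projection.
End ChainSpace.

Lemma geometric_small (R : realType) (c e : R) : 0 <= c -> 0 < e ->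
  exists k, c * 2^-1 ^+ k < e.
Proof.
move=> c0 e0; have := archi_boundP (divr_ge0 c0 (ltW e0)).
set k := Num.bound _ => ck; exists k.
rewrite exprVn ltr_pdivrMr ?exprn_gt0// mulrC -ltr_pdivrMr//.
by apply: (lt_trans ck); rewrite -natrX ltr_nat ltn_expl.
Qed.

Section OrthogonalProjection.
Context {R : realType}.
Local Notation coin := (@coin R).
Implicit Types (f g h u v : Omega -> R) (s : R).
Variables (p : R) (I J : set (seq nat)).
Hypothesis p1 : 1 < p.
Hypothesis JI : J `<=` I.
Local Notation V := (@chain_space R J).

Let p_ge1 : 1 <= p. Proof. exact: ltW. Qed.
Let p0 : 0 < p. Proof. exact: lt_trans p1. Qed.
Let two1 : 1 <= 2 :> R. Proof. by rewrite ler1n. Qed.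

Let Vm f : V f -> measurable_fun setT f. Proof. exact: chain_space_measurable. Qed.

Let V_lin c f g : V f -> V g -> V (fun w => c * f w + g w).
Proof. exact: span_lin. Qed.

Lemma chain_space_sub f g : V f -> V g -> V (fsub f g).
Proof.
move=> Vf Vg; have := V_lin (-1) Vg Vf; congr (Defs.span _).
by apply/funext => w; rewrite /fsub; ring.
Qed.

Lemma cylinder_sub f g : cylinder I f -> cylinder I g -> cylinder I (fsub f g).
Proof.
move=> cf cg; have := cylinder_lin (-1) cg cf; congr cylinder.
by apply/funext => w; rewrite /fsub; ring.
Qed.

Lemma chain_space_Lsub s f : V f -> Lsub s I f.
Proof.
move=> /chain_space_cylinder /(cylinder_Lsub s)[Lf Jf]; split => //.
by move=> w w' ww'; apply: Jf => a /JI; exact: ww'.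
Qed.

(** A single [h] must serve both exponents: [p_bounded] concerns the chosen [L_2] projection
    itself. *)
Definition proj_spec f h :=
  [/\ Lsub 2 I h, Lclosure 2 V h, forall v, V v -> ip (fsub f h) v = 0%E &
     inLp p f -> [/\ inLp p h, (Lnp p h <= (proj_const p)%:E * Lnp p f)%E & Lclosure p V h]].

Lemma proj_spec_exists f : Lsub 2 I f -> exists h, proj_spec f h.
Proof.
move=> [L2f If]; have [mf _] := L2f.
(* Approximation in [L_r] is approximation in [L_2] and, if [f] is in [L_p], also in [L_p], because
   norms increase with the exponent. *)
have [r [r2 Lrf rp]] : exists r : R, [/\ 2 <= r, inLp r f & inLp p f -> p <= r].
  have [Lpf|nLpf] := pselect (inLp p f); last by exists 2; split.
  exists (Num.max 2 p); rewrite !le_max !lexx orbT; split => //.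
  by case: (leP 2 p).
have r1 : 1 <= r by exact: le_trans r2.
pose e k : R := 2^-1 ^+ k.
have e0 k : 0 < e k by rewrite exprn_gt0// invr_gt0.
have edecr n k : e (n + k)%N <= e k.
  by rewrite /e exprD ler_piMl ?exprn_ge0// exprn_ile1// invf_le1.
have [_ ap] := @approx_Lsub R r I r1 f (conj Lrf If).
have /choice[fk fkP] : forall k, exists g, cylinder I g /\ (Lnp r (fsub f g) < (e k)%:E)%E.
  by move=> k; have [g cg fg] := ap _ (e0 k); exists g.
have cfk k : cylinder I (fk k) by have [] := fkP k.
have /choice[g gP] : forall k, exists g, V g /\ forall v, V v -> ip (fsub (fk k) g) v = 0%E.
  by move=> k; have [g [Vg og _]] := cylinder_proj J (cfk k); exists g.
have Vg k : V (g k) by have [] := gP k.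
have L2g k : inLp 2 (g k) by exact: chain_space_inLp.
have L2fk k : inLp 2 (fk k) by have [] := cylinder_Lsub 2 (cfk k).
have mfk k := cylinder_measurable (cfk k).
have ffk s k : 1 < s -> s <= r -> (Lnp s (fsub f (fk k)) <= (e k)%:E)%E.
  move=> s1 sr; have [_ /ltW] := fkP k; apply: le_trans.
  by apply: Lnp_le_exp => //; [exact: lt_trans s1|exact: measurable_funB].
have C0 s : 1 < s -> 0 <= proj_const s by move=> /proj_const_gt0 /ltW.
have est s k n : 1 < s -> s <= r ->
    (Lnp s (fsub (g (n + k)%N) (g k)) <= (proj_const s * 2 * e k)%:E)%E.
  move=> s1 sr; have s0 : 0 < s by exact: lt_trans s1.
  apply: (le_trans (@proj_bound _ I J s (fsub (fk (n + k)%N) (fk k)) _ s1 _ _ _)).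
  - exact: cylinder_sub.
  - exact: chain_space_sub.
  - move=> v Vv; have Lv := chain_space_inLp 2 Vv.
    have := (gP (n + k)%N).2 v Vv; have := (gP k).2 v Vv.
    rewrite ip_sub// ip_sub// ip_sub//; [|exact: inLpB..].
    rewrite !ip_sub//.
    move: (ip_fin (L2fk k) Lv) (ip_fin (L2g k) Lv).
    move: (ip_fin (L2fk (n + k)%N) Lv) (ip_fin (L2g (n + k)%N) Lv).
    case: (ip (fk (n + k)%N) v) => // a _; case: (ip (g (n + k)%N) v) => // b _.
    case: (ip (fk k) v) => // c _; case: (ip (g k) v) => // d _.
    rewrite -!EFinB => -[cd] -[ab]; congr EFin; lra.
  rewrite -mulrA [in leRHS]EFinM; apply: lee_wpmul2l; first by rewrite lee_fin C0.
  apply: (le_trans (Lnp_triangle (ltW s1) (mfk (n + k)%N) mf (mfk k))).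
  rewrite (Lnp_subC s (fk _) f) (_ : 2 * e k = e k + e k) ?EFinD; last by ring.
  apply: leeD; last exact: ffk.
  by apply: (le_trans (ffk s _ s1 sr)); rewrite lee_fin.
have l2 : (1 : R) < 2 by rewrite ltr1n.
have [k||h mh [aeh hdep]] := @ae_limit R g (proj_const 2 * 2).
- exact: Vm.
- by move=> k; have := est 2 k 1%N l2 r2; rewrite add1n.
(* The limit was built from [L_2] increments; Fatou's lemma carries the Cauchy estimate to every
   exponent up to [r]. *)
have hg s k : 1 < s -> s <= r -> (Lnp s (fsub h (g k)) <= (proj_const s * 2 * e k)%:E)%E.
  move=> s1 sr; apply: (@Lnp_fatou R s _ (fun n => fsub (g (n + k)%N) (g k))).
  - exact: lt_trans s1.
  - by apply: measurable_funB => //; exact: Vm.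
  - by move=> n; apply: measurable_funB; exact: Vm.
  - apply: filterS aeh => w cw; rewrite /fsub; apply: cvgB; last exact: cvg_cst.
    by rewrite (cvg_shiftn k (g ^~ w)).
  - by move=> n; exact: est.
have Lh s : 1 < s -> s <= r -> inLp s h.
  move=> s1 sr.
  have L1 : inLp s (fsub h (g 0%N)).
    split; first by apply: measurable_funB => //; exact: Vm.
    by apply: (le_lt_trans (hg s 0%N s1 sr)); rewrite ltry.
  have := inLpD (ltW s1) L1 (chain_space_inLp s (Vg 0%N)); congr inLp.
  by apply/funext => w; rewrite /fsub subrK.
have clh s : 1 < s -> s <= r -> Lclosure s V h.
  move=> s1 sr; split => // d d0.
  have c0 : 0 <= proj_const s * 2 by rewrite mulr_ge0// C0.
  have [k ck] := geometric_small c0 d0.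
  exists (g k) => //; apply: (le_lt_trans (hg s k s1 sr)); by rewrite lte_fin.
exists h; split.
- split; first exact: Lh.
  by move=> w w' ww'; apply: hdep => k; have [_] := chain_space_Lsub 2 (Vg k); apply.
- exact: clh.
- move=> v Vv; have Lv := chain_space_inLp 2 Vv; have L2h := Lh 2 l2 r2.
  have fhfin := ip_fin (inLpB two1 L2f L2h) Lv.
  apply/eqP; rewrite -abse_eq0 eq_le abse_ge0 andbT.
  apply/lee_addgt0Pr => d d0; rewrite add0e.
  pose N := fine (Lnp 2 v); have N0 : 0 <= N by rewrite fine_ge0// Lnp_ge0.
  have [|k kd] := @geometric_small R ((proj_const 2 * 2 + 1) * N) d _ d0.
    by rewrite mulr_ge0// addr_ge0// mulr_ge0// C0.
  have -> : ip (fsub f h) v = (ip (fsub f (fk k)) v - ip (fsub h (g k)) v)%E.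
    have := (gP k).2 v Vv; rewrite !ip_sub//.
    move: (ip_fin L2f Lv) (ip_fin L2h Lv) (ip_fin (L2fk k) Lv) (ip_fin (L2g k) Lv).
    case: (ip f v) => // a _; case: (ip h v) => // b _.
    case: (ip (fk k) v) => // a' _; case: (ip (g k) v) => // b' _.
    rewrite -!EFinB => -[ab]; congr EFin; lra.
  apply: (le_trans (lee_abs_sub _ _)).
  apply: (@le_trans _ _ ((e k)%:E * Lnp 2 v + (proj_const 2 * 2 * e k)%:E * Lnp 2 v)%E).
    apply: leeD.
      apply: (le_trans (ip_abs_le (inLpB two1 L2f (L2fk k)) Lv)).
      by apply: lee_wpmul2r; [exact: Lnp_ge0|exact: ffk].
    apply: (le_trans (ip_abs_le (inLpB two1 L2h (L2g k)) Lv)).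
    by apply: lee_wpmul2r; [exact: Lnp_ge0|exact: hg].
  rewrite -(fineK (inLp_fin Lv)) -/N -!EFinM -EFinD lee_fin.
  by move: kd; rewrite -/(e k); nra.
- move=> Lpf; have pr := rp Lpf; split; [exact: Lh| |exact: clh].
  apply/lee_addgt0Pr => d d0.
  (* Twice [e k] from [h - g k] and once from [f - fk k], each times the constant. *)
  have c0 : 0 <= proj_const p * 3 by rewrite mulr_ge0// C0.
  have [k kd] := geometric_small c0 d0.
  have Vgk := Vm (Vg k).
  have -> : h = (fun w => fsub h (g k) w + g k w).
    by apply/funext => w; rewrite /fsub subrK.
  apply: (le_trans (LnpD p_ge1 _ Vgk)); first exact: measurable_funB.
  have G : (Lnp p (g k) <= (proj_const p)%:E * (Lnp p f + (e k)%:E))%E.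
    apply: (le_trans (@proj_bound _ I J p (fk k) _ p1 (cfk k) (Vg k) (gP k).2)).
    apply: lee_wpmul2l; first by rewrite lee_fin C0.
    have -> : fk k = (fun w => fsub (fk k) f w + f w).
      by apply/funext => w; rewrite /fsub subrK.
    rewrite addeC; apply: (le_trans (LnpD p_ge1 _ mf)); first exact: measurable_funB.
    by apply: leeD => //; rewrite Lnp_subC; exact: ffk.
  apply: (le_trans (leeD (hg p k p1 pr) G)).
  rewrite -(fineK (inLp_fin Lpf)) -EFinD -!EFinM -!EFinD lee_fin.
  by move: kd; rewrite -/(e k); nra.
Qed.

Definition chain_projection f : Omega -> R :=
  match pselect (exists h, proj_spec f h) with
  | left H => projT1 (cid H)
  | right _ => f
  end.

Lemma chain_projectionP f : Lsub 2 I f -> proj_spec f (chain_projection f).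
Proof.
move=> Lf; rewrite /chain_projection; case: pselect => [H|]; first exact: projT2 (cid H).
by move=> /(_ (proj_spec_exists Lf)).
Qed.

Lemma Lsub2_lin c f g : Lsub 2 I f -> Lsub 2 I g -> Lsub 2 I (fun w => c * f w + g w).
Proof.
move=> [Lf If] [Lg Ig]; split; first by apply: inLpD => //; exact: inLpZ.
by move=> w w' ww'; rewrite (If w w')// (Ig w w').
Qed.

Lemma Lclosure_sub s f g : 1 <= s -> Lclosure s V f -> Lclosure s V g ->
  Lclosure s V (fsub f g).
Proof.
move=> s1 cf cg; have := Lclosure_lin s1 Vm V_lin (-1) cg cf; congr Lclosure.
by apply/funext => w; rewrite /fsub; ring.
Qed.

(** The projection is a choice, determined only almost everywhere. Linearity, idempotence and
    compatibility with equality almost everywhere all follow from this uniqueness. *)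
Lemma chain_projection_uniq f h h' : Lsub 2 I f -> inLp 2 h -> inLp 2 h' ->
  Lclosure 2 V h -> Lclosure 2 V h' ->
  (forall v, V v -> ip (fsub f h) v = 0%E) ->
  (forall v, V v -> ip (fsub f h') v = 0%E) -> Lnp 2 (fsub h h') = 0%E.
Proof.
move=> [Lf _] Lh Lh' ch ch' oh oh'; apply: (@orth_closure0 _ J).
- exact: inLpB.
- move=> v Vv; have Lv := chain_space_inLp 2 Vv.
  have := oh v Vv; have := oh' v Vv; rewrite !ip_sub//.
  move: (ip_fin Lf Lv) (ip_fin Lh Lv) (ip_fin Lh' Lv).
  case: (ip f v) => // a _; case: (ip h v) => // b _; case: (ip h' v) => // c _.
  rewrite -!EFinB => -[ac] -[ab]; congr EFin; lra.
- exact: Lclosure_sub.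
Qed.

Lemma chain_projection_orth_proj : orth_proj I chain_projection.
Proof.
have LP f : Lsub 2 I f -> inLp 2 (chain_projection f).
  by move=> /chain_projectionP[[]].
split.
- by move=> f /chain_projectionP[].
- move=> f g Lf Lg fg0; have [Pf cf of_ _] := chain_projectionP Lf.
  have [Pg cg og _] := chain_projectionP Lg.
  apply: (chain_projection_uniq Lf) => //; [exact: LP|exact: LP|].
  move=> v Vv; have Lv := chain_space_inLp 2 Vv; have LPg := LP g Lg.
  have := og v Vv; case: Lf => Lf _; case: Lg => Lg _.
  have : ip (fsub f g) v = 0%E.
    apply/eqP; rewrite -abse_eq0 eq_le abse_ge0 andbT.
    by apply: (le_trans (ip_abs_le (inLpB two1 Lf Lg) Lv)); rewrite fg0 mul0e.
  rewrite !ip_sub//; move: (ip_fin Lf Lv) (ip_fin Lg Lv) (ip_fin LPg Lv).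
  case: (ip f v) => // a _; case: (ip g v) => // b _.
  case: (ip (chain_projection g) v) => // c _.
  rewrite -!EFinB => -[ac] -[ab]; congr EFin; lra.
- move=> a f g Lf Lg; have [[Pf _] cf of_ _] := chain_projectionP Lf.
  have [[Pg _] cg og _] := chain_projectionP Lg.
  have Lfg := Lsub2_lin a Lf Lg; have [[Pfg _] cfg ofg _] := chain_projectionP Lfg.
  have LPP : inLp 2 (fun w => a * chain_projection f w + chain_projection g w).
    by apply: inLpD => //; exact: inLpZ.
  apply: (chain_projection_uniq Lfg) => //.
    by apply: Lclosure_lin.
  move=> v Vv; have Lv := chain_space_inLp 2 Vv.
  have := of_ v Vv; have := og v Vv.
  case: Lf => Lf _; case: Lg => Lg _; case: Lfg => Lfg _.
  rewrite !ip_sub// !ip_lin//.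
  move: (ip_fin Lf Lv) (ip_fin Lg Lv) (ip_fin Pf Lv) (ip_fin Pg Lv).
  case: (ip f v) => // x _; case: (ip g v) => // y _.
  case: (ip (chain_projection f) v) => // x' _; case: (ip (chain_projection g) v) => // y' _.
  rewrite -!EFinM -!EFinD => -[yy] -[xx]; congr EFin; nra.
- move=> f Lf; have [Pf cf of_ _] := chain_projectionP Lf.
  have [PPf cff off _] := chain_projectionP Pf; have [LPf _] := Pf; have [LPPf _] := PPf.
  apply: (chain_projection_uniq Pf) => // v Vv; rewrite /ip /fsub.
  by under eq_integral do rewrite subrr mul0r; rewrite integral0.
- move=> f g Lf Lg; have [[Pf _] cf of_ _] := chain_projectionP Lf.
  have [[Pg _] cg og _] := chain_projectionP Lg; case: Lf => Lf _; case: Lg => Lg _.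
  have := orth_closure (inLpB two1 Lf Pf) Pg of_ cg.
  have := orth_closure (inLpB two1 Lg Pg) Pf og cf.
  rewrite !ip_sub// (ipC g) (ipC (chain_projection g) (chain_projection f)).
  move: (ip_fin Pf Lg) (ip_fin Pf Pg) (ip_fin Lf Pg).
  case: (ip _ g) => // x _; case: (ip _ _) => // y _; case: (ip _ _) => // z _.
  rewrite -!EFinB => -[xy] -[zy]; congr EFin; lra.
Qed.

Lemma pclosure_eq (A S S' : set (Omega -> R)) : A `<=` [set f | measurable_fun setT f] ->
  (forall f, S f -> Lclosure p S' f) -> (forall f, S' f -> Lclosure p S f) ->
  (forall f, S f -> measurable_fun setT f) -> (forall f, S' f -> measurable_fun setT f) ->
  pclosure p A S = pclosure p A S'.
Proof.
have half (B B' : set (Omega -> R)) : A `<=` [set f | measurable_fun setT f] ->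
    (forall f, B f -> Lclosure p B' f) -> (forall f, B' f -> measurable_fun setT f) ->
    pclosure p A B `<=` pclosure p A B'.
  move=> Am BB' B'm f [Af fB]; split => // e e0.
  have [_] : Lclosure p B' f; last exact.
  apply: Lclosure_closed => //; first exact: Am.
  by move=> d d0; have [g /BB' Bg fg] := fB _ d0; exists g.
by move=> Am SS' S'S Sm S'm; apply/seteqP; split; apply: half.
Qed.

Lemma chain_space_complemented :
  orth_complemented p (proj_const p) I (pclosure p (Lsub p I) V).
Proof.
exists chain_projection; split; first exact: chain_projection_orth_proj.
- by move=> f /chain_projectionP[_ _ _ H] [/H[]].
apply: pclosure_eq.
- by move=> f [[]].
- move=> v Vv; have L2v := chain_space_Lsub 2 Vv.
  have [[[mP LP] _] cP oP _] := chain_projectionP L2v; have mv := Vm Vv.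
  split => // e e0; exists (chain_projection v); first by exists v => //; split => //; exact: chain_space_Lsub.
  (* [v] and its projection agree only almost everywhere, so [v] lies in the closure of the range,
     not necessarily in the range. *)
  have -> : Lnp p (fsub v (chain_projection v)) = Lnp p (fun=> 0).
    apply: Lnp_ae_eq => //; first exact: measurable_funB.
    have -> : fsub (fsub v (chain_projection v)) (fun=> 0) = fsub v (chain_projection v).
      by apply/funext => w; rewrite /fsub subr0.
    case: L2v => L2v _; apply: (@orth_closure0 _ J) => //.
      exact: inLpB.
    by apply: Lclosure_sub => //; exact: Lclosure_incl.
  by rewrite Lnp_cst// normr0 lte_fin.
- by move=> _ [f [L2f [Lpf _]] <-]; have [_ _ _ /(_ Lpf)[]] := chain_projectionP L2f.
- exact: Vm.
- by move=> _ [f [L2f _] <-]; have [[[]]] := chain_projectionP L2f.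
Qed.

End OrthogonalProjection.

(** * The spaces Rspace as closed spans of functions of chains *)

Section Identification.
Context {R : realType}.
Variables (p : R) (lt : nat -> nat -> Prop).
Hypothesis wf : well_founded lt.
Hypothesis lt_trans : forall a b c, lt a b -> lt b c -> lt a c.
Hypothesis p1 : 1 < p.
Implicit Types (f g u v : Omega -> R) (t s : nat).

Let p_ge1 : 1 <= p. Proof. exact: ltW. Qed.
Let p0 : 0 < p. Proof. exact: Order.POrderTheory.lt_trans p1. Qed.

Lemma RsysE t : Rsys p wf t = @Rbody R p lt t (fun s _ => Rsys p wf s).
Proof.
rewrite /Rsys Fix_eq// => x f g fg; congr Rbody.
by apply: functional_extensionality_dep => y; apply: functional_extensionality_dep.
Qed.

Definition is_pred t s := lt s t /\ forall r, lt r t -> r = s \/ lt r s.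

Lemma lt_irr s : ~ lt s s.
Proof.
by move=> ss; elim: (wf s) ss => x _ IH H; exact: (IH _ H H).
Qed.

Lemma is_pred_uniq t s s' : is_pred t s -> is_pred t s' -> s = s'.
Proof.
move=> [st H] [s't H']; have [//|ss'] := H' _ st.
by have [//|s's] := H _ s't; have := lt_irr (lt_trans ss' s's).
Qed.

(* The coordinates that the functions in [Rspace p wf t] depend on: the coordinate of a
   minimal element is never used. *)
Inductive node : nat -> seq nat -> Prop :=
| node_root t s : is_pred t s -> node t [::]
| node_succ t s a : is_pred t s -> node s a -> node t (0%N :: a)
| node_lim t s a : ~ (exists s, is_pred t s) -> lt s t -> node s a -> node t (s :: a).

Lemma node_min t a : ~ (exists s, lt s t) -> ~ node t a.
Proof. by move=> nt H; apply: nt; case: H => {t a} t s => [[]|a []|a _]; exists s. Qed.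

Lemma node_pred t s a : is_pred t s -> node t a -> a = [::] \/ exists2 b, node s b & a = 0%N :: b.
Proof.
move=> ts H; case: H ts => {t a} [t s' _|t s' a ts' na|t s' a nt]; first by left.
  by move=> ts; right; exists a => //; rewrite (is_pred_uniq ts ts').
by move=> _ _ ts; case: nt; exists s.
Qed.

Lemma node_limit t a : ~ (exists s, is_pred t s) -> node t a ->
  exists s b, [/\ lt s t, node s b & a = s :: b].
Proof.
move=> nt H; case: H nt => {t a} [t s ts|t s a ts _|t s a _ st na] nt.
- by case: nt; exists s.
- by case: nt; exists s.
- by exists s, a.
Qed.

Local Notation I t := (Icoord p wf t).
Local Notation V t := (@chain_space R (node t)).

Definition identified t := node t `<=` I t /\ Rspace p wf t = pclosure p (Lsub p (I t)) (V t).

Lemma Lsub_measurable J f : Lsub p J f -> measurable_fun setT f.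
Proof. by case=> -[]. Qed.

Lemma chain_space_Rspace t v : identified t -> V t v -> Rspace p wf t v.
Proof.
move=> [nI ->] Vv; split; first exact: (chain_space_Lsub nI).
have [_] := @Lclosure_incl R p (V t) p_ge1 (@chain_space_measurable R (node t)) v Vv.
exact.
Qed.

(** The closure of the constants must be shown to add nothing pointwise, not just almost everywhere.
    A function of one bit differs from its flip by a constant absolute value, and a constant [c] is
    flip-invariant, so this gap is at most twice the distance from [f] to [c]. *)
Lemma identified_min t : ~ (exists s, lt s t) -> identified t.
Proof.
move=> nt; rewrite /identified /Icoord /Rspace RsysE /Rbody.
case: pselect => // _ /=; split; first by move=> a /(node_min nt).
apply/seteqP; split => f.
  move=> [Lf [c fc]]; split => // e e0; exists f; last first.
    rewrite (_ : fsub f f = fun=> 0); first by rewrite Lnp_cst// normr0 lte_fin.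
    by apply/funext => w; rewrite /fsub subrr.
  by rewrite fc; exact: chain_space_cst.
move=> [[[mf Lf] If] cf]; split => //.
pose w0 : Omega := fun=> false.
exists (f w0); suff ff : f (flip [::] w0) = f w0.
  apply/funext => w; case w1 : (w [::]).
    by rewrite -ff; apply: If => a ->; rewrite /flip eqxx/= w1.
  by apply: If => a ->; rewrite w1.
have mff : measurable_fun setT (f \o flip [::]).
  by apply: measurableT_comp => //; exact: measurable_flip.
have diffE w : `|fsub f (f \o flip [::]) w| = `|f w0 - f (flip [::] w0)|.
  rewrite /fsub /=; case w1 : (w [::]).
    rewrite distrC; congr (`|_ - _|); apply: If => a ->; rewrite /flip eqxx/= w1//.
  by congr (`|_ - _|); apply: If => a ->; rewrite ?/flip ?eqxx/= w1.
have : (`|f w0 - f (flip [::] w0)|%:E <= 0%E)%E.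
  apply/lee_addgt0Pr => e e0; rewrite add0e.
  have e20 : 0 < e / 2 by rewrite divr_gt0.
  have [v Vv fv] := cf _ e20.
  have [c vc] : exists c, v = fun=> c.
    have [T TJ vT] := chain_space_cylinder Vv; exists (v w0); apply/funext => w.
    by apply: vT => a /TJ /(node_min nt).
  have -> : `|f w0 - f (flip [::] w0)|%:E = Lnp p (fsub f (f \o flip [::])).
    by rewrite LnpE; under eq_integral do rewrite diffE; rewrite -LnpE Lnp_cst ?normr_id.
  have mv := chain_space_measurable Vv.
  apply: (le_trans (Lnp_triangle p_ge1 mf mv mff)).
  rewrite (splitr e) EFinD; apply: leeD; first exact: ltW.
  rewrite (_ : fsub v _ = fsub v f \o flip [::]); last by apply/funext => w; rewrite vc.
  rewrite Lnp_comp; [|exact: preserving_flip|exact: measurable_funB].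
  by rewrite Lnp_subC ltW.
by rewrite lee_fin normr_le0 subr_eq0 => /eqP.
Qed.

(** A right inverse of [shiftw 0] with root bit [c]; coordinates not of the form [0 :: b] do not
    occur at a successor and get the default [false]. *)
Definition insert (c : bool) (w : Omega) : Omega := fun a =>
  match a with
  | [::] => c
  | n :: b => if n == 0%N then w b else false
  end.

Lemma measurable_insert c : measurable_fun setT (insert c).
Proof.
apply: measurable_fun_omega => -[|n b] /=.
  by case: c; [rewrite (_ : mkset _ = setT)|rewrite (_ : mkset _ = set0)] => //;
    apply/seteqP; split.
case: (n == 0%N); first exact: measurable_coord.
by rewrite (_ : mkset _ = set0)//; apply/seteqP; split.
Qed.

(** Insertion does not preserve the measure. But one of [w] and its flip at the root has root bit
    [c], so the composite is dominated by [|u|] plus its flip. *)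
Lemma Lnp_insert (J : set (seq nat)) c u : measurable_fun setT u ->
  depends_on [set a | a = [::] \/ exists2 b, J b & a = 0%N :: b] u ->
  (Lnp p (u \o insert c) <= Lnp p u + Lnp p u)%E.
Proof.
move=> mu Ju.
have mui : measurable_fun setT (u \o insert c).
  by apply: measurableT_comp => //; exact: measurable_insert.
have muf : measurable_fun setT (u \o flip [::]).
  by apply: measurableT_comp => //; exact: measurable_flip.
rewrite -(Lnp_comp p (@preserving_shiftw R 0) mui).
rewrite -[X in (_ <= _ + X)%E](Lnp_comp p (@preserving_flip R [::]) mu).
have mn f : measurable_fun setT f -> measurable_fun setT (fun w => `|f w|).
  by move=> mf; exact: measurableT_comp.
have nE f : Lnp p f = Lnp p (fun w => `|f w|).
  by rewrite !LnpE; under [in RHS]eq_integral do rewrite normr_id.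
rewrite (nE u) (nE (u \o flip [::])).
apply: le_trans (LnpD p_ge1 (mn _ mu) (mn _ muf)).
apply: Lnp_le => //.
- by apply: measurableT_comp => //; exact: measurable_shiftw.
- by apply: measurable_funD; exact: mn.
move=> w /=; rewrite [leRHS]ger0_norm ?addr_ge0//.
have [e|e] : u (insert c (shiftw 0 w)) = u w \/ u (insert c (shiftw 0 w)) = u (flip [::] w).
- have [wc|wc] := eqVneq (w [::]) c; [left|right]; apply: Ju => a [->|[b _ ->]] //=.
  by rewrite /flip eqxx; move: wc; case: (w [::]); case: (c).
- by rewrite e lerDl.
- by rewrite e lerDr.
Qed.

(** The root is a prefix of everything: multiplying by a function of the root bit keeps functions of
    chains, and fixing that bit brings them back to [node s]. *)
Lemma identified_succ t s : is_pred t s -> identified s -> identified t.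
Proof.
move=> ts [nIs Rs]; have [st _] := ts.
rewrite /identified /Icoord /Rspace RsysE /Rbody.
case: pselect => [_|]; last by case; exists s.
case: pselect => [h|]; last by case; exists s.
have -> : projT1 (cid h) = s by exact: is_pred_uniq (projT2 (cid h)) ts.
cbn zeta; rewrite -/(Icoord p wf s) -/(Rspace p wf s) /=.
set It := [set a | _]; have nIt : node t `<=` It.
  by move=> a /(node_pred ts)[->|[b /nIs Ib ->]]; [left|right; exists b].
split => //.
have VIt v : V t v -> Lsub p It v by exact: (chain_space_Lsub nIt).
apply/seteqP; split => g.
  move=> [Lg [b0 [b1 [+ + gE]]]]; rewrite Rs => -[Lb0 cb0] [Lb1 cb1].
  split => // e e0; have e20 : 0 < e / 2 by rewrite divr_gt0.
  have [v0 V0 bv0] := cb0 _ e20; have [v1 V1 bv1] := cb1 _ e20.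
  have W (chi : Omega -> R) v : depends_on [set` [:: [::]]] chi -> V s v ->
      V t (fun w => chi w * v (shiftw 0 w)).
    move=> chiD; apply: span_weight => u [C [CJ Cch uC]].
    apply: span_incl; exists ([::] :: [seq 0%N :: a | a <- C]); split.
    - move=> a; rewrite inE => /orP[/eqP->|/mapP[b /CJ nb ->]]; first exact: node_root ts.
      exact: node_succ ts nb.
    - move=> a b; rewrite !inE => /orP[/eqP->|/mapP[a' aC ->]]; first by rewrite prefix0s.
      by move=> /orP[/eqP->|/mapP[b' bC ->]]; [rewrite orbT|rewrite !prefix_cons eqxx Cch].
    - move=> w w' ww'; congr (_ * _).
        by apply: chiD => a /=; rewrite inE => /eqP->; apply: ww'; rewrite /= mem_head.
      by apply: uC => a aC; apply: ww'; rewrite /= inE map_f ?orbT.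
  pose chi c (w : Omega) : R := if w [::] == c then 1 else 0.
  have chiD c : depends_on [set` [:: [::]]] (chi c).
    by move=> w w' ww'; rewrite /chi ww'//= inE.
  pose k w := 1 * (chi true w * v1 (shiftw 0 w)) + chi false w * v0 (shiftw 0 w).
  exists k; first by apply: span_lin; exact: W.
  have mb0 := Lsub_measurable Lb0; have mb1 := Lsub_measurable Lb1.
  have mv0 := chain_space_measurable V0; have mv1 := chain_space_measurable V1.
  have m0 : measurable_fun setT (fsub b0 v0) by exact: measurable_funB.
  have m1 : measurable_fun setT (fsub b1 v1) by exact: measurable_funB.
  have mn f : measurable_fun setT f -> measurable_fun setT (fun w => `|f (shiftw 0 w)|).
    move=> mf; apply: (measurableT_comp (@normr_measurable R setT)).
    by apply: measurableT_comp => //; exact: measurable_shiftw.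
  have nE f : measurable_fun setT f -> Lnp p (fun w => `|f (shiftw 0 w)|) = Lnp p f.
    move=> mf; rewrite -(Lnp_comp p (@preserving_shiftw R 0) mf) !LnpE.
    by under eq_integral do rewrite normr_id.
  have mg := Lsub_measurable Lg.
  have mh : measurable_fun setT k.
    have : V t k by apply: span_lin; exact: W.
    exact: chain_space_measurable.
  apply: (@le_lt_trans _ _ (Lnp p (fun w => `|fsub b0 v0 (shiftw 0 w)| + `|fsub b1 v1 (shiftw 0 w)|))).
    apply: Lnp_le => //; first exact: measurable_funB.
      by apply: measurable_funD; exact: mn.
    move=> w; rewrite [leRHS]ger0_norm ?addr_ge0// /fsub gE /k /chi.
    by case: (w [::]) => /=; rewrite !(mul1r, mul0r, addr0, add0r) ?lerDl ?lerDr.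
  apply: (le_lt_trans (LnpD p_ge1 (mn _ m0) (mn _ m1))).
  by rewrite !nE// (splitr e) EFinD lteD.
move=> [Lg cg]; split => //.
have [[mg gfin] Ig] := Lg.
(* The two components of [g] are recovered by fixing the root bit. *)
have Rins c : Rspace p wf s (g \o insert c).
  rewrite Rs; have mgi : measurable_fun setT (g \o insert c).
    by apply: measurableT_comp => //; exact: measurable_insert.
  split.
    split; last first.
      move=> w w' ww'; apply: Ig => a [->//|[b Ib ->]] /=; exact: ww'.
    split => //; apply: (le_lt_trans (Lnp_insert c mg Ig)).
    by rewrite lte_add_pinfty.
  move=> e e0; have e20 : 0 < e / 2 by rewrite divr_gt0.
  have [v Vv gv] := cg _ e20; have [[mv _] Iv] := VIt v Vv.
  exists (v \o insert c).
    have : V s (fun w => 1 * v (insert c w)); last first.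
      by congr (Defs.span _); apply/funext => w; rewrite mul1r.
    move: v {gv mv Iv} Vv; apply: span_weight => u [C [CJ Cch uC]].
    apply: span_incl; exists [seq behead a | a <- C & a != [::]]; split.
    - move=> _ /mapP[a + ->]; rewrite mem_filter => /andP[a0 /CJ/(node_pred ts)].
      by move=> [ae|[b nb ->]//]; rewrite ae in a0.
    - move=> _ _ /mapP[a + ->] /mapP[b + ->]; rewrite !mem_filter.
      move=> /andP[a0 aC] /andP[b0 bC]; have := Cch a b aC bC.
      have [ae|[a' _ ->]] := node_pred ts (CJ a aC); first by rewrite ae in a0.
      have [be|[b' _ ->]] := node_pred ts (CJ b bC); first by rewrite be in b0.
      by rewrite !prefix_cons eqxx.
    - move=> w w' ww'; congr (_ * _); apply: uC => a /= aC.
      have [->//|[b _ ab]] := node_pred ts (CJ a aC).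
      rewrite ab /=; apply: ww'; apply/mapP; exists a; last by rewrite ab.
      by rewrite mem_filter aC ab.
  have -> : fsub (g \o insert c) (v \o insert c) = fsub g v \o insert c by [].
  have mgv : measurable_fun setT (fsub g v) by exact: measurable_funB.
  apply: (le_lt_trans (@Lnp_insert (I s) c _ mgv _)).
    by move=> w w' ww'; rewrite /fsub (Ig w w')// (Iv w w').
  by rewrite [in X in (_ < X)%E](splitr e) EFinD lteD.
exists (g \o insert false), (g \o insert true); split => // w.
have E c : w [::] = c -> g w = (g \o insert c) (shiftw 0 w).
  by move=> wc; apply: Ig => a [->//|[b _ ->]].
by case wc : (w [::]); rewrite (E _ wc).
Qed.

(** Comparable nonempty lists have the same head, so a nonempty chain lies in one block
    [s :: node s]: no products across independent summands arise. *)
Lemma identified_limit t : (exists s, lt s t) -> ~ (exists s, is_pred t s) ->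
  (forall s, lt s t -> identified s) -> identified t.
Proof.
move=> [s0 s0t] nt IH; rewrite /identified /Icoord /Rspace RsysE /Rbody.
case: pselect => [_|]; last by case; exists s0.
case: pselect => [[s ts]|_]; first by case: nt; exists s.
cbn zeta => /=; set It := [set a | _].
have nIt : node t `<=` It.
  move=> a /(node_limit nt)[s [b [st nb ->]]]; exists s, st, b => //.
  by have [H _] := IH s st; exact: H.
split => //; set G := [set g | _].
have Gm f : G f -> measurable_fun setT f.
  move=> [s [st [g Rg ->]]]; apply: measurableT_comp; last exact: measurable_shiftw.
  by move: Rg; have [_] := IH s st; rewrite /Rspace => -> [/Lsub_measurable].
have sGm f : Defs.span G f -> measurable_fun setT f.
  move: f; apply: span_ind => [|c f g Gf mg]; first exact: measurable_cst.
  by apply: measurable_funD => //; apply: measurable_funM => //; exact: Gm.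
have Vm f : V t f -> measurable_fun setT f by exact: chain_space_measurable.
have Vlin c f g : V t f -> V t g -> V t (fun w => c * f w + g w) by exact: span_lin.
apply: pclosure_eq => //.
- by move=> f /Lsub_measurable.
- apply: span_ind; first by apply: Lclosure_incl => //; exact: span0.
  move=> c f g [s [st [f' Rf ->]]] cg; apply: Lclosure_lin => //.
  move: Rf; have [_] := IH s st; rewrite /Rspace => -> [/Lsub_measurable mf' cf'].
  split; first by apply: measurableT_comp => //; exact: measurable_shiftw.
  move=> e e0; have [v Vv fv] := cf' _ e0.
  exists (v \o shiftw s); last first.
    have -> : fsub (f' \o shiftw s) (v \o shiftw s) = fsub f' v \o shiftw s by [].
    rewrite Lnp_comp//; first exact: preserving_shiftw.
    by apply: measurable_funB => //; exact: chain_space_measurable Vv.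
  have : V t (fun w => 1 * v (shiftw s w)); last first.
    by congr (Defs.span _); apply/funext => w; rewrite mul1r.
  move: v {fv} Vv; apply: span_weight => u [C [CJ Cch uC]].
  apply: span_incl; exists [seq s :: a | a <- C]; split.
  + by move=> _ /mapP[a /CJ na ->]; exact: node_lim.
  + by move=> _ _ /mapP[a aC ->] /mapP[b bC ->]; rewrite !prefix_cons eqxx Cch.
  + by move=> w w' ww'; congr (_ * _); apply: uC => a aC; apply: ww'; rewrite /= map_f.
move=> f Vf; apply: Lclosure_incl => //.
have : Defs.span G (fun w => 1 * f (id w)); last first.
  by congr (Defs.span _); apply/funext => w; rewrite mul1r.
move: f Vf; apply: span_weight => u [C [CJ Cch uC]].
apply: span_incl.
(* The empty chain gives a constant, which any summand contains; [s0] is taken. *)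
have [s [st Cs]] : exists s, lt s t /\ forall a, a \in C -> exists2 b, node s b & a = s :: b.
  case: C CJ Cch {uC} => [|a C] CJ Cch; first by exists s0.
  have [s [b [st nb ab]]] := node_limit nt (CJ a (mem_head _ _)).
  exists s; split => // c cC; have [s' [b' [s't nb' cb']]] := node_limit nt (CJ c cC).
  have := Cch a c (mem_head _ _) cC; rewrite ab cb' !prefix_cons.
  by move=> /orP[] /andP[/eqP e _]; [rewrite e|rewrite -e]; exists b' => //; rewrite ?e// -e.
exists s, st.
(* A right inverse of [shiftw s], which exhibits [u] as a copy of a function on the block [s]. *)
pose ins (w : Omega) : Omega := fun a => if a is n :: b then (n == s) && w b else false.
exists (u \o ins); last first.
  apply/funext => w; rewrite mul1r /=; apply: uC => a /Cs[b _ ->] /=.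
  by rewrite eqxx.
apply: (chain_space_Rspace (IH s st)); apply: span_incl.
exists [seq behead a | a <- C]; split.
- by move=> _ /mapP[a /Cs[b nb ->] ->].
- move=> _ _ /mapP[a aC ->] /mapP[b bC ->]; have := Cch a b aC bC.
  by have [a' _ ->] := Cs a aC; have [b' _ ->] := Cs b bC; rewrite !prefix_cons eqxx.
- move=> w w' ww'; apply: uC => a aC; have [b _ ab] := Cs a aC; rewrite ab /= eqxx /=.
  by apply: ww'; apply/mapP; exists a => //; rewrite ab.
Qed.

Lemma identifiedP t : identified t.
Proof.
elim: (wf t) => {}t _ IH.
have [ex|nex] := pselect (exists s, lt s t); last exact: identified_min.
have [[s ts]|np] := pselect (exists s, is_pred t s); last exact: identified_limit.
by apply: (identified_succ ts); apply: IH; case: ts.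
Qed.

End Identification.

Theorem mainTheorem4 (R : realType) (p : R) (lt : nat -> nat -> Prop)
    (wf : well_founded lt)
    (lt_trans : forall a b c, lt a b -> lt b c -> lt a c)
    (lt_total : forall a b, [\/ lt a b, a = b | lt b a])
    (t : nat) :
  1 < p ->
  let q := p / (p - 1) in
  let pstar := Num.max p q in
  orth_complemented p ((pstar - 1) ^+ 2 * (pstar / 2) `^ (3 / 2))
    (Icoord p wf t) (Rspace p wf t).
Proof.
move=> p1 q pstar; have [nI ->] := identifiedP wf lt_trans p1 t.
exact: chain_space_complemented.
Qed.
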